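(* If $M$ is an almost complex surface in the nearly Kähler $S^3\times S^3$ with parallel second fundamental form, then $M$ is totally geodesic.
   Context: $S^3$ is the set of unit quaternions; tangent vectors at $(p,q)\in S^3\times S^3$ are written $Z=(U,V)$ with $U\in T_pS^3$, $V\in T_qS^3$. The nearly Kähler structure on $S^3\times S^3$ consists of the almost complex structure $JZ=\frac{1}{\sqrt3}\bigl(2pq^{-1}V-U,\,-2qp^{-1}U+V\bigr)$ and the metric $g(Z,Z')=\frac12\bigl(\langle Z,Z'\rangle+\langle JZ,JZ'\rangle\bigr)$, where $\langle\cdot,\cdot\rangle$ is the standard product metric on $S^3\times S^3$ (quaternion multiplication is used throughout). An almost complex surface is an (immersed) 2-dimensional submanifold $M$ with $J(TM)=TM$; it carries the metric induced by $g$. Let $\nabla$ be its Levi-Civita connection, $\nabla^\perp$ the normal connection and $h$ the second fundamental form. Put $(\nabla h)(X,Y,Z)=\nabla^\perp_X h(Y,Z)-h(\nabla_XY,Z)-h(Y,\nabla_XZ)$ for tangent $X,Y,Z$. The second fundamental form is parallel if $\nabla h=0$ everywhere; $M$ is totally geodesic if $h=0$ everywhere. *)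

(* Defs.v *)
From HB Require Import structures.
From mathcomp Require Import all_boot all_order all_algebra.
From mathcomp Require Import all_classical all_reals all_analysis.

Set Implicit Arguments.
Unset Strict Implicit.
Unset Printing Implicit Defensive.

Import Order.TTheory GRing.Theory Num.Theory.
Import numFieldNormedType.Exports.

Local Open Scope classical_set_scope.
Local Open Scope ring_scope.

(* The row (a, b, c, d) stands for the quaternion a + b i + c j + d k. *)
Notation quat R := 'rV[R]_4.

Section Quaternions.
Variable R : realType.

Definition mkquat (a b c d : R) : quat R :=
  \row_(i < 4) nth 0 [:: a; b; c; d] i.

Definition q0 (x : quat R) : R := x ord0 (inord 0).
Definition q1 (x : quat R) : R := x ord0 (inord 1).
Definition q2 (x : quat R) : R := x ord0 (inord 2).
Definition q3 (x : quat R) : R := x ord0 (inord 3).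

Definition qmul (x y : quat R) : quat R := mkquat
  (q0 x * q0 y - q1 x * q1 y - q2 x * q2 y - q3 x * q3 y)
  (q0 x * q1 y + q1 x * q0 y + q2 x * q3 y - q3 x * q2 y)
  (q0 x * q2 y - q1 x * q3 y + q2 x * q0 y + q3 x * q1 y)
  (q0 x * q3 y + q1 x * q2 y - q2 x * q1 y + q3 x * q0 y).

Definition qdot (x y : quat R) : R := \sum_(i < 4) x ord0 i * y ord0 i.

Definition qconj (x : quat R) : quat R :=
  mkquat (q0 x) (- q1 x) (- q2 x) (- q3 x).

Definition qinv (x : quat R) : quat R := (qdot x x)^-1 *: qconj x.

End Quaternions.

Section SmoothMaps.
Variable R : realType.

Fixpoint Ck (V W : normedModType R) (k : nat) (O : set V) (f : V -> W) : Prop :=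
  match k with
  | 0 => forall x, O x -> {for x, continuous f}
  | k'.+1 => (forall x, O x -> differentiable f x) /\
             (forall v, Ck k' O (fun x => 'D_v f x))
  end.

(* C^oo; only meaningful on an open set O. *)
Definition smooth_on (V W : normedModType R) (O : set V) (f : V -> W) : Prop :=
  forall k, Ck k O f.

End SmoothMaps.

(* Tensors and connections on a submanifold S of a normed space V, with tangent
   spaces T p (p in S).  It is used for S = S^3 x S^3 in H x H and for open
   subsets of R^2. *)
Section Connections.
Variables (R : realType) (V : normedModType R).
Implicit Types (S : set V) (T : V -> set V) (g : V -> V -> V -> R).

(* Smoothness on a subset S means existence of a smooth extension to an open
   neighbourhood of S. *)
Definition vector_field S T (X : V -> V) : Prop :=
  (exists O : set V, [/\ open O, S `<=` O & smooth_on O X]) /\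
  (forall p, S p -> T p (X p)).

Definition bilinear_on (E : set V) (B : V -> V -> V) : Prop :=
  (forall (a : R) u u' w, E u -> E u' -> E w ->
     B (a *: u + u') w = a *: B u w + B u' w) /\
  (forall (a : R) u w w', E u -> E w -> E w' ->
     B u (a *: w + w') = a *: B u w + B u w').

(* The difference between an affine connection on S and the flat derivative of
   V is tensorial, so a connection D is encoded by the V-valued bilinear forms
   G p on T p such that (D_X Y)(p) = dY_p(X p) + G p (X p) (Y p). *)
Definition cov (G : V -> V -> V -> V) (X Y : V -> V) (p : V) : V :=
  'D_(X p) Y p + G p (X p) (Y p).

Definition affine_connection S T (G : V -> V -> V -> V) : Prop :=
  (forall p, S p -> bilinear_on (T p) (G p)) /\
  (forall X Y, vector_field S T X -> vector_field S T Y ->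
     forall p, S p -> T p (cov G X Y p)).

Definition torsion_free S T (G : V -> V -> V -> V) : Prop :=
  forall X Y, vector_field S T X -> vector_field S T Y ->
  forall p, S p -> cov G X Y p - cov G Y X p = 'D_(X p) Y p - 'D_(Y p) X p.

Definition metric_connection S T g (G : V -> V -> V -> V) : Prop :=
  forall X Y Z, vector_field S T X -> vector_field S T Y ->
  vector_field S T Z -> forall p, S p ->
  'D_(X p) (fun x => g x (Y x) (Z x)) p =
    g p (cov G X Y p) (Z p) + g p (Y p) (cov G X Z p).

(* The values of G p on T p are determined by these conditions (Koszul); its
   values elsewhere are irrelevant. *)
Definition levi_civita S T g (G : V -> V -> V -> V) : Prop :=
  [/\ affine_connection S T G, torsion_free S T G & metric_connection S T g G].

(* The g-orthogonal projection of z on the orthogonal complement of E. *)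
Definition normal_part (g : V -> V -> R) (E : set V) (z : V) : V :=
  xget 0 [set w | E (z - w) /\ forall t, E t -> g w t = 0].

End Connections.

Section NearlyKaehler.
Variable R : realType.
Let H := quat R.
Implicit Types p Z W : (H * H)%type.

Definition S3S3 : set (H * H) :=
  [set p | qdot p.1 p.1 = 1 /\ qdot p.2 p.2 = 1].

Definition TS3S3 p : set (H * H) :=
  [set Z | qdot p.1 Z.1 = 0 /\ qdot p.2 Z.2 = 0].

Definition nkJ p Z : H * H :=
  (Num.sqrt 3)^-1 *:
    (2 *: qmul (qmul p.1 (qinv p.2)) Z.2 - Z.1,
     - (2 *: qmul (qmul p.2 (qinv p.1)) Z.1) + Z.2).

Definition dot_prod Z W : R := qdot Z.1 W.1 + qdot Z.2 W.2.

Definition nk_metric p Z W : R :=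
  2^-1 * (dot_prod Z W + dot_prod (nkJ p Z) (nkJ p W)).

Definition nk_levi_civita (D : H * H -> H * H -> H * H -> H * H) : Prop :=
  levi_civita S3S3 TS3S3 nk_metric D.

End NearlyKaehler.

Section Surfaces.
Variable R : realType.

Record chart (M : topologicalType) := Chart {
  chart_dom : set M;
  chart_img : set 'rV[R]_2;
  chart_map : M -> 'rV[R]_2;
  chart_param : 'rV[R]_2 -> M }.

Definition is_chart (M : topologicalType) (c : chart M) : Prop :=
  [/\ open (chart_dom c) /\ open (chart_img c),
      forall m, chart_dom c m ->
        chart_img c (chart_map c m) /\ chart_param c (chart_map c m) = m,
      forall x, chart_img c x ->
        chart_dom c (chart_param c x) /\ chart_map c (chart_param c x) = x,
      forall m, chart_dom c m -> {for m, continuous (chart_map c)} &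
      forall x, chart_img c x -> {for x, continuous (chart_param c)}].

Record smooth_surface := SmoothSurface {
  surface_space :> topologicalType;
  atlas : set (chart surface_space);
  surface_hausdorff : hausdorff_space surface_space;
  surface_second_countable : @second_countable surface_space;
  atlas_chart : forall c, atlas c -> is_chart c;
  atlas_cover : forall m, exists2 c, atlas c & chart_dom c m;
  atlas_smooth : forall c c', atlas c -> atlas c' ->
    smooth_on (chart_img c `&` [set x | chart_dom c' (chart_param c x)])
              (chart_map c' \o chart_param c) }.

End Surfaces.

(* Geometry of a parametrized surface phi : W -> S^3 x S^3, W open in R^2.
   A vector field on the surface is given by its components X : R^2 -> R^2, the
   corresponding field along phi being push X. *)
Section Immersions.
Variable R : realType.
Let H := quat R.
Let E := 'rV[R]_2.
Variable phi : E -> H * H.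

Definition tangent_plane (x : E) : set (H * H) := range (fun v => 'D_v phi x).

Definition push (X : E -> E) (x : E) : H * H := 'D_(X x) phi x.

Definition induced_metric (x v w : E) : R :=
  nk_metric (phi x) ('D_v phi x) ('D_w phi x).

Definition induced_levi_civita (W : set E) (G : E -> E -> E -> E) : Prop :=
  levi_civita W (fun=> setT) induced_metric G.

(* The pull-back of the connection D by phi, on vector fields xi along phi. *)
Definition cov_along (D : H * H -> H * H -> H * H -> H * H)
    (X : E -> E) (xi : E -> H * H) (x : E) : H * H :=
  'D_(X x) xi x + D (phi x) (push X x) (xi x).

Definition normal_proj (x : E) (z : H * H) : H * H :=
  normal_part (nk_metric (phi x)) (tangent_plane x) z.

Definition sff D (X Y : E -> E) (x : E) : H * H :=
  normal_proj x (cov_along D X (push Y) x).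

Definition normal_cov D (X : E -> E) (xi : E -> H * H) (x : E) : H * H :=
  normal_proj x (cov_along D X xi x).

(* (nabla h)(X, Y, Z), with G the Levi-Civita connection of the surface. *)
Definition cov_sff D G (X Y Z : E -> E) (x : E) : H * H :=
  normal_cov D X (sff D Y Z) x
  - sff D (cov G X Y) Z x - sff D Y (cov G X Z) x.

End Immersions.

Section AlmostComplexSurfaces.
Variables (R : realType) (M : smooth_surface R).
Let H := quat R.
Let E := 'rV[R]_2.
Variable f : M -> H * H.

Definition local_rep (c : chart R M) : E -> H * H := f \o chart_param c.

Definition immersed_surface : Prop :=
  (forall m, S3S3 (f m)) /\
  (forall c, atlas c ->
     smooth_on (chart_img c) (local_rep c) /\
     forall x, chart_img c x ->
       forall v, 'D_v (local_rep c) x = 0 -> v = 0).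

Definition almost_complex_surface : Prop :=
  immersed_surface /\
  (forall c, atlas c -> forall x, chart_img c x ->
     nkJ (local_rep c x) @` tangent_plane (local_rep c) x =
     tangent_plane (local_rep c) x).

(* The Levi-Civita connection of M, expressed in each chart. *)
Definition surface_levi_civita (nabla : chart R M -> E -> E -> E -> E) : Prop :=
  forall c, atlas c ->
    induced_levi_civita (local_rep c) (chart_img c) (nabla c).

(* h and nabla h are tensors, hence it is enough to consider vector fields
   defined on a chart domain. *)
Definition parallel_sff D (nabla : chart R M -> E -> E -> E -> E) : Prop :=
  forall c, atlas c -> forall X Y Z : E -> E,
  vector_field (chart_img c) (fun=> setT) X ->
  vector_field (chart_img c) (fun=> setT) Y ->
  vector_field (chart_img c) (fun=> setT) Z ->
  forall x, chart_img c x ->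
    cov_sff (local_rep c) D (nabla c) X Y Z x = 0.

Definition totally_geodesic D : Prop :=
  forall c, atlas c -> forall X Y : E -> E,
  vector_field (chart_img c) (fun=> setT) X ->
  vector_field (chart_img c) (fun=> setT) Y ->
  forall x, chart_img c x -> sff (local_rep c) D X Y x = 0.

End AlmostComplexSurfaces.

(* Main.v *)
From HB Require Import structures.
Require Import Defs.
From mathcomp Require Import all_boot all_order all_algebra.
From mathcomp Require Import all_classical all_reals all_analysis.
From mathcomp Require Import ring lra.

Set Implicit Arguments.
Unset Strict Implicit.
Unset Printing Implicit Defensive.

Import Order.TTheory GRing.Theory Num.Theory.
Import numFieldNormedType.Exports.

Local Open Scope classical_set_scope.
Local Open Scope ring_scope.

(** Left translation identifies the tangent vector (p a, q b) at (p, q), with a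
    and b imaginary quaternions, with the vector conj(omega) a + omega b of C^3,
    where omega = exp(2 i pi / 3).  In this picture J is multiplication by i, the
    metric is 4/3 of the standard one, and the Levi-Civita connection is, on
    left-invariant fields,
      conn_form z w = - 4/3 Re(z) x w + 1/3 conj(z) x conj(w)
    with the complex bilinear cross product ([nk_connection_translate]).  Its
    first term is complex linear in w, the second one antilinear, hence
      (nabla_z J) w = - 2/3 i conj(z) x conj(w)          ([conn_form_mulI]).

    Let e be a tangent vector of an almost complex surface.  The tangent plane
    is the complex line of e, where the product conj(z) x conj(w) vanishes, so
    that the second fundamental form satisfies h(X, JY) = J h(X, Y).  As h is
    symmetric, all its values lie in the complex line of the single vector
    a = h(e, e) ([second_form_complex_line]).  If h is parallel, the normal
    derivatives of the values of h, in particular those of a and of J a in the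
    direction e, stay in this complex line ([parallel_complex_line]).
    Subtracting J times the first derivative from the second one leaves the
    normal vector (nabla_e J) a, which is therefore a complex multiple of a.
    But conj(e) x conj(a) is orthogonal to a and i a, so it is zero; since a is
    orthogonal to e and i e, its length is |e| |a|, and a = 0
    ([conj_cross_complex_line], [sff_diag_eq0]).

    Two analytic facts enter.  The symmetry of h is the commutation of second
    derivatives ([derive_comm]).  And the term h(Y, nabla_X Z) of the
    derivative of h differentiates nabla_X Z, where nabla is only assumed to
    satisfy the axioms of the Levi-Civita connection; its coefficients are
    smooth by Koszul's formula ([connection_smooth]). *)

(** * Calculus of smooth maps on an open set *)

Section SmoothCalculus.
Variables (R : realType) (E : normedModType R) (O : set E).
Hypothesis openO : open O.

Lemma near_of_open x : O x -> \forall y \near x, O y.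
Proof. by move=> Ox; apply: open_nbhs_nbhs; split. Qed.

Lemma derive_eq_on (F : normedModType R) (f g : E -> F) v x :
  (forall y, O y -> f y = g y) -> O x -> 'D_v f x = 'D_v g x.
Proof.
move=> fg Ox; apply: near_eq_derive.
by near do apply: fg; exact: near_of_open.
Unshelve. all: by end_near. Qed.

(** The differential is a choice depending on the whole function, so the one of
    [f] has to be shown to satisfy the expansion that characterises the one of
    [g]. *)
Lemma differentiable_near_eq (F : normedModType R) (f g : E -> F) x :
  (\forall y \near x, f y = g y) -> differentiable f x -> differentiable g x.
Proof.
move=> fg df.
have fgx : f x = g x by exact: nbhs_singleton fg.
have cdf := diff_continuous df.
have Dg : g \o shift x = cst (g x) + 'd f x +o_ 0 id.
  have := diff_locally df; rewrite /= => Df.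
  apply/eqaddoP => e e0.
  have /eqaddoP/(_ e e0) := Df.
  have fg0 : \forall h \near (0 : E), f (h + x) = g (h + x).
    move: fg; rewrite (near_shift 0 x)/=; apply: filter_app.
    by near=> h; rewrite /= subr0.
  apply: filter_app; apply: filter_app fg0; near=> h => fgh /=.
  by rewrite !fctE/= fgh fgx.
have dg : 'd g x = 'd f x :> (E -> F) by exact: diff_unique.
by apply/diff_locallyP; rewrite dg.
Unshelve. all: by end_near. Qed.

Lemma Ck_eq (F : normedModType R) k (f g : E -> F) :
  (forall y, O y -> f y = g y) -> Ck k O f -> Ck k O g.
Proof.
elim: k f g => [|k IH] f g fg /=.
  move=> cf x Ox; rewrite /prop_for /continuous_at -fg//.
  apply: cvg_trans (cf x Ox); apply: near_eq_cvg.
  by near do apply: fg; exact: near_of_open.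
move=> [df Df]; split=> [x Ox|v].
  apply: differentiable_near_eq (df x Ox).
  by near do apply: fg; exact: near_of_open.
by apply: IH (Df v) => y Oy; exact: derive_eq_on.
Unshelve. all: by end_near. Qed.

Lemma CkW (F : normedModType R) k (f : E -> F) : Ck k.+1 O f -> Ck k O f.
Proof.
elim: k f => [|k IH] f [df Df]; first by move=> x /df/differentiable_continuous.
by split=> // v; exact: IH.
Qed.

Lemma CkD (F : normedModType R) k (f g : E -> F) :
  Ck k O f -> Ck k O g -> Ck k O (fun y => f y + g y).
Proof.
elim: k f g => [|k IH] f g /=; first by
  move=> cf cg x Ox; apply: cvgD; [exact: cf|exact: cg].
move=> [df Df] [dg Dg]; split=> [x Ox|v].
  by apply: differentiableD; [exact: df|exact: dg].
apply: Ck_eq (IH _ _ (Df v) (Dg v)) => y Oy /=.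
by rewrite -deriveD//; apply: diff_derivable; [exact: df|exact: dg].
Qed.

Lemma CkM k (f g : E -> R) :
  Ck k O f -> Ck k O g -> Ck k O (fun y => f y * g y).
Proof.
elim: k f g => [|k IH] f g; first by
  move=> cf cg x Ox; apply: cvgM; [exact: cf|exact: cg].
move=> Cf Cg; have [cf cg] := (CkW Cf, CkW Cg).
move: Cf Cg => [df Df] [dg Dg]; split=> [x Ox|v].
  by apply: differentiableM; [exact: df|exact: dg].
apply: Ck_eq (CkD (IH _ _ cf (Dg v)) (IH _ _ cg (Df v))) => y Oy /=.
by rewrite -deriveM//; apply: diff_derivable; [exact: df|exact: dg].
Qed.

Lemma derive_lin (F G : normedModType R) (l : {linear F -> G}) (f : E -> F) v y :
  continuous l -> differentiable f y ->
  'D_v (fun y => l (f y)) y = l ('D_v f y).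
Proof.
move=> cl df; have dl := linear_differentiable (f y) cl.
rewrite [LHS]deriveE; last exact: differentiable_comp.
rewrite deriveE// diff_comp//=.
by have /(congr1 (@^~ ('d f y v))) := diff_lin (f y) cl.
Qed.

Lemma Ck_lin (F G : normedModType R) k (l : {linear F -> G}) (f : E -> F) :
  continuous l -> Ck k O f -> Ck k O (fun y => l (f y)).
Proof.
move=> cl; elim: k f => [|k IH] f.
  by move=> cf x Ox; apply: continuous_comp; [exact: cf|exact: cl].
move=> [df Df]; split=> [x Ox|v].
  by apply: differentiable_comp; [exact: df|exact: linear_differentiable].
by apply: Ck_eq (IH _ (Df v)) => y Oy /=; rewrite derive_lin//; exact: df.
Qed.

Lemma Ck_cst (F : normedModType R) k (c : F) : Ck k O (fun=> c).
Proof.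
elim: k c => [|k IH] c; first by move=> x _; exact: cvg_cst.
split=> [x _|v]; first exact: differentiable_cst.
by apply: Ck_eq (IH 0) => y _; rewrite derive_cst.
Qed.

Lemma CkV k (f : E -> R) : (forall y, O y -> f y != 0) ->
  Ck k O f -> Ck k O (fun y => (f y)^-1).
Proof.
move=> f0; elim: k => [|k IH] Cf.
  by move=> x Ox; apply: cvgV; [exact: f0|exact: Cf].
have cV := IH (CkW Cf); case: Cf => df Df; split=> [x Ox|v].
  by apply: differentiableV; [exact: df|exact: f0].
have := CkM (CkM (Ck_cst k (-1 : R)) (CkM cV cV)) (Df v).
apply: Ck_eq => y Oy /=.
rewrite deriveV; [|exact: f0|by apply: diff_derivable; exact: df].
by rewrite -[RHS]/(_ * _) mulN1r expr2 invfM.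
Qed.

Lemma is_derive_line (f : E -> R) a u (s : R) :
  differentiable f (a + s *: u) ->
  is_derive s 1 (fun s : R => f (a + s *: u)) ('D_u f (a + s *: u)).
Proof.
move=> df.
have dl : is_diff s (fun s : R => a + s *: u) (fun s : R => s *: u).
  have := is_diffD (is_diff_cst a s) (is_diff_scalel s u).
  by rewrite add0r.
have dc : differentiable (fun s : R => f (a + s *: u)) s.
  by apply: (@differentiable_comp _ _ _ _ (fun s : R => a + s *: u) f).
apply: DeriveDef; first exact: diff_derivable.
rewrite !deriveE// (@diff_comp _ _ _ _ (fun s : R => a + s *: u) f)//=.
by rewrite diff_val scale1r.
Qed.

Lemma MVT_0h (F dF : R -> R) (h : R) : 0 < h ->
  (forall s, 0 <= s <= h -> is_derive s 1 F (dF s)) ->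
  exists2 s, 0 <= s <= h & F h - F 0 = dF s * h.
Proof.
move=> h0 dFP; have [s||s + E1] := @MVT R F dF 0 h h0.
- by rewrite in_itv/= => /andP[s0 sh]; apply: dFP; rewrite !ltW.
- apply: derivable_within_continuous => s; rewrite in_itv/= => /dFP.
  by case.
- by rewrite in_itv/= => /andP[/ltW s0 /ltW sh]; exists s; rewrite ?s0// E1 subr0.
Qed.

(** The mean value theorem, applied once in each direction. *)
Lemma second_difference (f : E -> R) x u v (h : R) : 0 < h -> Ck 2 O f ->
  (forall s t, 0 <= s <= h -> 0 <= t <= h -> O (x + s *: u + t *: v)) ->
  exists s t, [/\ 0 <= s <= h, 0 <= t <= h &
    f (x + h *: u + h *: v) - f (x + h *: u) - f (x + h *: v) + f x =
    h ^+ 2 * 'D_v ('D_u f) (x + s *: u + t *: v)].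
Proof.
move=> h0 [df Df] inO.
have hh : 0 <= h <= h by rewrite lexx ltW.
have zh : 0 <= (0 : R) <= h by rewrite lexx ltW.
have df0 s : 0 <= s <= h -> differentiable f (x + s *: u).
  by move=> sh; apply: df; have := inO s 0 sh zh; rewrite scale0r addr0.
have dfh s : 0 <= s <= h -> differentiable f (x + h *: v + s *: u).
  by move=> sh; apply: df; have := inO s h sh hh; rewrite addrAC.
pose psi (s : R) := f (x + h *: v + s *: u) - f (x + s *: u).
have dpsi s : 0 <= s <= h -> is_derive s 1 psi
    ('D_u f (x + h *: v + s *: u) - 'D_u f (x + s *: u)).
  move=> sh; have := is_derive_line (df0 s sh).
  by move=> d1; have := is_derive_line (dfh s sh) => d2; exact: is_deriveB.
have [s sh E1] := MVT_0h h0 dpsi.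
pose chi (t : R) := 'D_u f (x + s *: u + t *: v).
have dchi t : 0 <= t <= h -> is_derive t 1 chi
    ('D_v ('D_u f) (x + s *: u + t *: v)).
  by move=> th; apply: is_derive_line; have [+ _] := Df u; apply; exact: inO.
have [t th E2] := MVT_0h h0 dchi.
exists s, t; split=> //.
move: E1 E2; rewrite /psi /chi !scale0r !addr0.
rewrite [x + h *: v + s *: u]addrAC => E1 E2; rewrite E2 in E1.
rewrite expr2 -[h * h * _]mulrA [h * _]mulrC [h * _]mulrC -E1.
by rewrite [x + h *: v + h *: u]addrAC; ring.
Qed.

Lemma near_dist (g : E -> R) x e : {for x, continuous g} -> 0 < e ->
  \forall y \near x, `|g y - g x| < e.
Proof.
move=> /cvgrPdist_lt/(_ e) cg e0; apply: filterS (cg e0) => y /=.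
by rewrite distrC.
Qed.

Lemma two_close (c l1 l2 a b d1 d2 : R) : c != 0 ->
  l1 = c * d1 -> l2 = c * d2 -> l1 = l2 ->
  `|d1 - a| < `|a - b| / 2 -> `|d2 - b| < `|a - b| / 2 -> False.
Proof.
move=> c0 -> -> /(mulfI c0) <- A B.
suff : `|a - b| < `|a - b| by rewrite ltxx.
rewrite -{1}[a](subrK d1) -addrA.
apply: le_lt_trans (ler_normD _ _) _.
by rewrite [ltRHS](splitr `|a - b|) distrC; exact: ltrD.
Qed.

(** Schwarz's theorem: the second difference over a small parallelogram does not
    depend on the order of its sides, and by [second_difference] it is the same
    multiple of values of both mixed derivatives near [x]. *)
Lemma derive_comm (f : E -> R) u v x : Ck 2 O f -> O x ->
  'D_v ('D_u f) x = 'D_u ('D_v f) x.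
Proof.
move=> Cf Ox; apply/eqP; rewrite -subr_eq0 -normr_eq0; apply/negPn/negP => ab.
set a := 'D_v ('D_u f) x in ab *; set b := 'D_u ('D_v f) x in ab *.
pose e := `|a - b| / 2.
have e0 : 0 < e by rewrite divr_gt0// lt_neqAle eq_sym ab/=.
have ca : {for x, continuous ('D_v ('D_u f))}.
  by have [_ /(_ u) /= [_ /(_ v) /=]] := Cf; apply.
have cb : {for x, continuous ('D_u ('D_v f))}.
  by have [_ /(_ v) /= [_ /(_ u) /=]] := Cf; apply.
have /nbhs_ballP[d /= d0 Hd] : nbhs x (O `&`
    ([set y | `|'D_v ('D_u f) y - a| < e] `&`
     [set y | `|'D_u ('D_v f) y - b| < e])).
  exact (filterI (near_of_open Ox) (filterI (near_dist ca e0) (near_dist cb e0))).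
(* The parallelogram of sides h u and h v at x lies in the ball of radius d. *)
pose h := d / (1 + `|u| + `|v|) / 2.
have D0 : 0 < 1 + `|u| + `|v| by rewrite -addrA ltr_pwDl// addr_ge0.
have h0 : 0 < h by rewrite !divr_gt0.
have near_x s t : 0 <= s <= h -> 0 <= t <= h -> ball x d (x + s *: u + t *: v).
  move=> /andP[s0 sh] /andP[t0 th].
  rewrite -ball_normE/= -addrA opprD addrA subrr sub0r normrN.
  apply: le_lt_trans (ler_normD _ _) _.
  rewrite !normrZ !ger0_norm//.
  have : s * `|u| + t * `|v| <= h * (1 + `|u| + `|v|).
    have := ler_wpM2r (normr_ge0 u) sh; have := ler_wpM2r (normr_ge0 v) th.
    by move: h0; lra.
  move=> /le_lt_trans; apply.
  by rewrite /h mulrAC divfK ?gt_eqF// ltr_pdivrMr// ltr_pMr// ltr1n.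
have [s [t [sh th E1]]] : exists s t, [/\ 0 <= s <= h, 0 <= t <= h &
    f (x + h *: u + h *: v) - f (x + h *: u) - f (x + h *: v) + f x =
    h ^+ 2 * 'D_v ('D_u f) (x + s *: u + t *: v)].
  by apply: second_difference => // s t sh th; have [] := Hd _ (near_x s t sh th).
have [t' [s' [th' sh' E2]]] : exists s t, [/\ 0 <= s <= h, 0 <= t <= h &
    f (x + h *: v + h *: u) - f (x + h *: v) - f (x + h *: u) + f x =
    h ^+ 2 * 'D_u ('D_v f) (x + s *: v + t *: u)].
  apply: second_difference => // s' t' sh' th'; rewrite addrAC.
  by have [] := Hd _ (near_x t' s' th' sh').
have [_ [/= A _]] := Hd _ (near_x _ _ sh th).
have [_ [_ /= B]] := Hd _ (near_x _ _ sh' th').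
rewrite [x + s' *: u + _]addrAC in B.
apply: (@two_close _ _ _ a b _ _ (lt0r_neq0 (exprn_gt0 2 h0)) E1 E2 _ A B).
by rewrite [x + h *: v + h *: u]addrAC; congr (_ + _); exact: addrAC.
Qed.

Lemma smooth_eq (F : normedModType R) (f g : E -> F) :
  (forall y, O y -> f y = g y) -> smooth_on O f -> smooth_on O g.
Proof. by move=> fg sf k; exact: Ck_eq (sf k). Qed.

Lemma smooth_cst (F : normedModType R) (c : F) : smooth_on O (fun=> c).
Proof. by move=> k; exact: Ck_cst. Qed.

Lemma smoothD (F : normedModType R) (f g : E -> F) :
  smooth_on O f -> smooth_on O g -> smooth_on O (fun y => f y + g y).
Proof. by move=> sf sg k; exact: CkD. Qed.

Lemma smoothM (f g : E -> R) :
  smooth_on O f -> smooth_on O g -> smooth_on O (fun y => f y * g y).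
Proof. by move=> sf sg k; exact: CkM. Qed.

Lemma smoothN (f : E -> R) : smooth_on O f -> smooth_on O (fun y => - f y).
Proof.
move=> sf; apply: smooth_eq (smoothM (smooth_cst (-1 : R)) sf) => y _.
by rewrite mulN1r.
Qed.

Lemma smoothB (f g : E -> R) :
  smooth_on O f -> smooth_on O g -> smooth_on O (fun y => f y - g y).
Proof. by move=> sf sg; apply: smoothD => //; exact: smoothN. Qed.

Lemma smoothV (f : E -> R) : (forall y, O y -> f y != 0) ->
  smooth_on O f -> smooth_on O (fun y => (f y)^-1).
Proof. by move=> f0 sf k; exact: CkV. Qed.

Lemma smooth_lin (F G : normedModType R) (l : {linear F -> G}) (f : E -> F) :
  continuous l -> smooth_on O f -> smooth_on O (fun y => l (f y)).
Proof. by move=> cl sf k; exact: Ck_lin. Qed.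

Lemma smooth_derive (F : normedModType R) (f : E -> F) v :
  smooth_on O f -> smooth_on O ('D_v f).
Proof. by move=> sf k; have [_] := sf k.+1; exact. Qed.

Lemma smooth_diff (F : normedModType R) (f : E -> F) x :
  smooth_on O f -> O x -> differentiable f x.
Proof. by move=> sf; have [+ _] := sf 1%N; apply. Qed.

Lemma smooth_derivable (F : normedModType R) (f : E -> F) x v :
  smooth_on O f -> O x -> derivable f x v.
Proof. by move=> sf Ox; apply: diff_derivable; exact: smooth_diff. Qed.

End SmoothCalculus.

Lemma smooth_onS (R : realType) (E F : normedModType R) (O W : set E) (f : E -> F) :
  W `<=` O -> smooth_on O f -> smooth_on W f.
Proof.
move=> WO sf k; have := sf k; elim: k f {sf} => [|k IH] f /=.
  by move=> cf x /WO; exact: cf.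
by move=> [df Df]; split=> [x /WO|v]; [exact: df|exact: IH (Df v)].
Qed.

(** * Maps with values in a space of row vectors or in a product *)

Section VectorCalculus.
Variable R : realType.

(** In finite dimension, by expansion in the canonical basis. *)
Lemma linear_rV_continuous n (F : normedModType R) (l : {linear 'rV[R]_n -> F}) :
  continuous l.
Proof.
move=> x; apply: differentiable_continuous.
have -> : (l : _ -> _) = \sum_(j < n) (fun x : 'rV[R]_n => x 0 j *: l 'e_j).
  apply/funext => y; rewrite fct_sumE {1}[y]row_sum_delta linear_sum.
  by apply: eq_bigr => j _; rewrite linearZ.
apply: differentiable_sum => j; apply: differentiableZl.
exact: differentiable_coord.
Qed.

Lemma derive_scale (E F : normedModType R) (f : E -> R) (g : E -> F) x v :
  derivable f x v -> derivable g x v -> {for x, continuous g} ->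
  is_derive x v (fun y => f y *: g y) ('D_v f x *: g x + f x *: 'D_v g x).
Proof.
move=> df dg cg.
suff H : h^-1 *: (((fun y => f y *: g y) \o shift x) (h *: v) - f x *: g x)
    @[h --> 0^'] --> 'D_v f x *: g x + f x *: 'D_v g x.
  by apply: DeriveDef; [apply/cvg_ex; eexists; exact: H|exact: cvg_lim H].
have -> : (fun h : R =>
    h^-1 *: (((fun y => f y *: g y) \o shift x) (h *: v) - f x *: g x)) =
   (fun h => (h^-1 *: (f (h *: v + x) - f x)) *: g (h *: v + x) +
      f x *: (h^-1 *: (g (h *: v + x) - g x))).
  apply/funext => h /=; rewrite -[h^-1 *: (f _ - f x)]/(h^-1 * _) -[in RHS]scalerA.
  rewrite [f x *: (h^-1 *: _)]scalerA [f x * _]mulrC -[in RHS]scalerA.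
  by rewrite -scalerDr scalerBl [f x *: (_ - _)]scalerBr addrA subrK.
apply: cvgD; last by apply: cvgZl_tmp; exact: dg.
apply: cvgZ; first exact: df.
have c0 : g (h *: v + x) @[h --> (0 : R)] --> g x.
  have ch : h *: v + x @[h --> (0 : R)] --> x.
    rewrite -[X in _ --> X]add0r -[X in _ --> X + _](scale0r v).
    by apply: cvgD; [exact: scalel_continuous|exact: cvg_cst].
  exact: (cvg_comp _ _ ch cg).
by apply: cvg_trans c0; apply: cvg_app; exact: cvg_within.
Qed.

(** The product rule for a bilinear map; expanding the second argument in a
    basis spares the joint continuity of [B]. *)
Lemma derive_bilinear n (E F G : normedModType R) (B : F -> 'rV[R]_n -> G)
    (f : E -> F) (a : E -> 'rV[R]_n) x v :
  (forall p, linear (B p)) -> (forall z, linear (B^~ z)) ->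
  (forall z, continuous (B^~ z)) ->
  differentiable f x -> derivable a x v ->
  is_derive x v (fun y => B (f y) (a y)) (B ('D_v f x) (a x) + B (f x) ('D_v a x)).
Proof.
move=> lB1 lB2 cB df da.
have sumB p z : B p z = \sum_(j < n) z 0 j *: B p 'e_j.
  pose L := GRing.isLinear.Build _ _ _ _ _ (lB1 p).
  pose Bp : {linear _ -> _} := HB.pack (B p) L.
  rewrite {1}[z]row_sum_delta -[B p]/(Bp : _ -> _) linear_sum.
  by apply: eq_bigr => j _; rewrite linearZ.
have -> : (fun y => B (f y) (a y)) = \sum_(j < n) (fun y => a y 0 j *: B (f y) 'e_j).
  by apply/funext => y; rewrite fct_sumE sumB.
rewrite [B _ (a x)]sumB [B (f x) _]sumB -big_split/=.
apply: is_derive_sum => j.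
pose L := GRing.isLinear.Build _ _ _ _ _ (lB2 'e_j).
pose Bj : {linear _ -> _} := HB.pack (B^~ 'e_j) L.
have cBj : continuous Bj by exact: cB.
have dBf : differentiable (fun y => B (f y) 'e_j) x.
  by apply: (@differentiable_comp _ _ _ _ f Bj) => //; exact: linear_differentiable.
have -> : B ('D_v f x) 'e_j = 'D_v (fun y => B (f y) 'e_j) x.
  by rewrite -[RHS]/('D_v (fun y => Bj (f y)) x) derive_lin.
have -> : ('D_v a x) 0 j = 'D_v (fun y => a y 0 j) x.
  by rewrite derive_mx// mxE.
rewrite addrC; apply: derive_scale.
- by move/derivable_mxP : da; exact.
- exact: diff_derivable.
- exact: differentiable_continuous.
Qed.

Lemma smooth_id (E : normedModType R) (O : set E) : open O -> smooth_on O id.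
Proof.
move=> oO [|k]; first by move=> x _; exact: cvg_id.
split=> [x _|v]; first exact: ex_diff.
by apply: (Ck_eq oO _ (Ck_cst oO k v)) => y _; rewrite derive_id.
Qed.

Lemma smooth_sum n (E F : normedModType R) (O : set E) (h : 'I_n -> E -> F) :
  open O -> (forall i, smooth_on O (h i)) -> smooth_on O (fun y => \sum_i h i y).
Proof.
move=> oO; elim: n h => [|n IH] h sh.
  by apply: (smooth_eq oO _ (smooth_cst oO 0)) => y _; rewrite big_ord0.
have := smoothD oO (sh ord0) (IH (fun i => h (lift ord0 i)) (fun i => sh _)).
by apply: (smooth_eq oO) => y _; rewrite big_ord_recl.
Qed.

Lemma smooth_rV n (E : normedModType R) (O : set E) (a : E -> 'rV[R]_n) : open O ->
  (forall i, smooth_on O (fun y => a y 0 i)) -> smooth_on O a.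
Proof.
move=> oO sa.
have : smooth_on O (fun y => \sum_(j < n) a y 0 j *: ('e_j : 'rV[R]_n)).
  apply: smooth_sum => // i.
  have lin_i : linear (fun s : R => s *: ('e_i : 'rV[R]_n)).
    by move=> s t u; rewrite scalerDl scalerA.
  pose Li := GRing.isLinear.Build _ _ _ _ _ lin_i.
  pose l : {linear R -> 'rV[R]_n} := HB.pack (fun s : R => s *: ('e_i : 'rV[R]_n)) Li.
  by apply: (smooth_lin oO (l := l)) => //; exact: scalel_continuous.
by apply: (smooth_eq oO) => y _ /=; rewrite -row_sum_delta.
Qed.

Lemma smooth_coord n (E : normedModType R) (O : set E) (a : E -> 'rV[R]_n) i :
  open O -> smooth_on O a -> smooth_on O (fun y => a y 0 i).
Proof.
move=> oO sa.
have lin_i : linear (fun u : 'rV[R]_n => u 0 i : R) by move=> s t u; rewrite !mxE.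
pose Li := GRing.isLinear.Build _ _ _ _ _ lin_i.
pose l : {linear 'rV[R]_n -> R} := HB.pack (fun u : 'rV[R]_n => u 0 i : R) Li.
by apply: (smooth_lin oO (l := l)) => //; exact: coord_continuous.
Qed.

End VectorCalculus.

Section Components.
Variables (R : realType) (E : normedModType R) (O : set E).
Hypothesis openO : open O.
Implicit Types (v w y : E).

Lemma smooth_fst (F G : normedModType R) (f : E -> F * G) :
  smooth_on O f -> smooth_on O (fun y => (f y).1).
Proof.
move=> sf; have l1 : linear (@fst F G) by [].
pose L := GRing.isLinear.Build _ _ _ _ _ l1.
pose l : {linear (F * G)%type -> F} := HB.pack (@fst F G) L.
by apply: (smooth_lin openO (l := l)) => // p; exact: cvg_fst.
Qed.

Lemma smooth_snd (F G : normedModType R) (f : E -> F * G) :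
  smooth_on O f -> smooth_on O (fun y => (f y).2).
Proof.
move=> sf; have l1 : linear (@snd F G) by [].
pose L := GRing.isLinear.Build _ _ _ _ _ l1.
pose l : {linear (F * G)%type -> G} := HB.pack (@snd F G) L.
by apply: (smooth_lin openO (l := l)) => // p; exact: cvg_snd.
Qed.

Lemma derive_fst (F G : normedModType R) (f : E -> F * G) y v :
  differentiable f y -> 'D_v (fun y => (f y).1) y = ('D_v f y).1.
Proof.
move=> sf; have l1 : linear (@fst F G) by [].
pose L := GRing.isLinear.Build _ _ _ _ _ l1.
pose l : {linear (F * G)%type -> F} := HB.pack (@fst F G) L.
by apply: (@derive_lin R E _ _ l) => // p; exact: cvg_fst.
Qed.

Lemma derive_snd (F G : normedModType R) (f : E -> F * G) y v :
  differentiable f y -> 'D_v (fun y => (f y).2) y = ('D_v f y).2.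
Proof.
move=> sf; have l1 : linear (@snd F G) by [].
pose L := GRing.isLinear.Build _ _ _ _ _ l1.
pose l : {linear (F * G)%type -> G} := HB.pack (@snd F G) L.
by apply: (@derive_lin R E _ _ l) => // p; exact: cvg_snd.
Qed.

Lemma derive_coord n (a : E -> 'rV[R]_n) y v i :
  differentiable a y -> 'D_v (fun y => a y 0 i) y = ('D_v a y) 0 i.
Proof. by move=> da; rewrite derive_mx ?mxE//; exact: diff_derivable. Qed.

Lemma derive_comm_rV n (a : E -> 'rV[R]_n) v w y : smooth_on O a -> O y ->
  'D_v ('D_w a) y = 'D_w ('D_v a) y.
Proof.
move=> sa Oy.
have da u z (Oz : O z) := smooth_diff (smooth_derive u sa) Oz.
apply/rowP => i.
refine (etrans (esym (derive_coord v i (da w y Oy))) (etrans _ (derive_coord w i (da v y Oy)))).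
have coord_eq v' w' : 'D_v' (fun z => 'D_w' a z 0 i) y = 'D_v' ('D_w' (fun z => a z 0 i)) y.
  exact: (derive_eq_on openO v'
    (fun z Oz => esym (derive_coord w' i (smooth_diff sa Oz))) Oy).
refine (etrans (coord_eq v w) (etrans _ (esym (coord_eq w v)))).
exact: (derive_comm openO w v (smooth_coord i openO sa 2) Oy).
Qed.

End Components.

(** * The Hermitian space C^3 and its cross product *)

Section HermitianSpace.
Variable R : realType.
Local Notation C3 := 'rV[R]_6.
Implicit Types (e a z w : C3) (s t : R).

(** A vector of C^3 is stored as its real part followed by its imaginary part. *)
Definition mkC3 (x0 x1 x2 y0 y1 y2 : R) : C3 :=
  \row_i nth 0 [:: x0; x1; x2; y0; y1; y2] i.

Definition re z k : R := z ord0 (inord k).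
Definition im z k : R := z ord0 (inord k.+3).

Lemma reD z w k : re (z + w) k = re z k + re w k. Proof. by rewrite /re mxE. Qed.
Lemma reN z k : re (- z) k = - re z k. Proof. by rewrite /re mxE. Qed.
Lemma reZ s z k : re (s *: z) k = s * re z k. Proof. by rewrite /re mxE. Qed.
Lemma re0 k : re 0 k = 0. Proof. by rewrite /re mxE. Qed.
Lemma imD z w k : im (z + w) k = im z k + im w k. Proof. by rewrite /im mxE. Qed.
Lemma imN z k : im (- z) k = - im z k. Proof. by rewrite /im mxE. Qed.
Lemma imZ s z k : im (s *: z) k = s * im z k. Proof. by rewrite /im mxE. Qed.
Lemma im0 k : im 0 k = 0. Proof. by rewrite /im mxE. Qed.

Lemma mkC3E x0 x1 x2 y0 y1 y2 (z := mkC3 x0 x1 x2 y0 y1 y2) :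
  ((re z 0 = x0) * (re z 1 = x1) * (re z 2 = x2) *
   (im z 0 = y0) * (im z 1 = y1) * (im z 2 = y2))%type.
Proof. by rewrite /re /im !mxE !inordK. Qed.

Definition coordE := (reD, reN, reZ, re0, imD, imN, imZ, im0, mkC3E).

Lemma C3P z w : re z 0 = re w 0 -> re z 1 = re w 1 -> re z 2 = re w 2 ->
  im z 0 = im w 0 -> im z 1 = im w 1 -> im z 2 = im w 2 -> z = w.
Proof.
move=> h0 h1 h2 h3 h4 h5; apply/rowP => i; rewrite -[i]inord_val.
by case: i => [[|[|[|[|[|[|m]]]]]] im]/=.
Qed.

Ltac C3ring := apply: C3P; rewrite !coordE; ring.

Definition mulI z : C3 :=
  mkC3 (- im z 0) (- im z 1) (- im z 2) (re z 0) (re z 1) (re z 2).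

Definition dotC z w : R :=
  re z 0 * re w 0 + re z 1 * re w 1 + re z 2 * re w 2 +
  (im z 0 * im w 0 + im z 1 * im w 1 + im z 2 * im w 2).

(** conj(z) x conj(w), with the complex bilinear cross product. *)
Definition conj_cross z w : C3 :=
  let r i j := (re z i * re w j - re z j * re w i) -
               (im z i * im w j - im z j * im w i) in
  let m i j := - (re z i * im w j - re z j * im w i) -
               (im z i * re w j - im z j * re w i) in
  mkC3 (r 1 2) (r 2 0) (r 0 1) (m 1 2) (m 2 0) (m 0 1).

(** Re(z) x w. *)
Definition re_cross z w : C3 :=
  let r i j := re z i * re w j - re z j * re w i in
  let m i j := re z i * im w j - re z j * im w i in
  mkC3 (r 1 2) (r 2 0) (r 0 1) (m 1 2) (m 2 0) (m 0 1).

(** The Levi-Civita connection of the nearly Kaehler metric on left-invariant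
    fields.  It is sealed so that additivity lemmas do not see the sum in its
    body. *)
Definition conn_form z w : C3 :=
  locked (3^-1 *: conj_cross z w - (4 / 3) *: re_cross z w).

Lemma conn_formE z w :
  conn_form z w = 3^-1 *: conj_cross z w - (4 / 3) *: re_cross z w.
Proof. by rewrite /conn_form -lock. Qed.

Lemma mulID z w : mulI (z + w) = mulI z + mulI w.
Proof. by rewrite /mulI; C3ring. Qed.

Lemma mulIZ s z : mulI (s *: z) = s *: mulI z.
Proof. by rewrite /mulI; C3ring. Qed.

Lemma mulIN z : mulI (- z) = - mulI z.
Proof. by rewrite /mulI; C3ring. Qed.

Lemma mulIK z : mulI (mulI z) = - z.
Proof. by rewrite /mulI; C3ring. Qed.

Lemma mulI0 : mulI 0 = 0.
Proof. by rewrite -(scale0r (0 : C3)) mulIZ !scale0r. Qed.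

Lemma dotCC z w : dotC z w = dotC w z.
Proof. by rewrite /dotC; ring. Qed.

Lemma dotCDl z w a : dotC (z + w) a = dotC z a + dotC w a.
Proof. by rewrite /dotC !coordE; ring. Qed.

Lemma dotCZl s z a : dotC (s *: z) a = s * dotC z a.
Proof. by rewrite /dotC !coordE; ring. Qed.

Lemma dotCNl z a : dotC (- z) a = - dotC z a.
Proof. by rewrite /dotC !coordE; ring. Qed.

Lemma dotCBl z w a : dotC (z - w) a = dotC z a - dotC w a.
Proof. by rewrite dotCDl dotCNl. Qed.

Lemma dotCDr z w a : dotC a (z + w) = dotC a z + dotC a w.
Proof. by rewrite dotCC dotCDl !(dotCC a). Qed.

Lemma dotCZr s z a : dotC a (s *: z) = s * dotC a z.
Proof. by rewrite dotCC dotCZl (dotCC a). Qed.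

Lemma dotC0l z : dotC 0 z = 0.
Proof. by rewrite /dotC !coordE; ring. Qed.

Lemma dotC_mulI z w : dotC (mulI z) (mulI w) = dotC z w.
Proof. by rewrite /dotC /mulI !coordE; ring. Qed.

Lemma dotC_mulIl z w : dotC (mulI z) w = - dotC z (mulI w).
Proof. by rewrite /dotC /mulI !coordE; ring. Qed.

Lemma dotC_mulI_self z : dotC z (mulI z) = 0.
Proof. by rewrite /dotC /mulI !coordE; ring. Qed.

Lemma dotC_eq0 z : (dotC z z == 0) = (z == 0).
Proof.
apply/eqP/eqP => [|->]; last by rewrite dotC0l.
move=> zz; have H : forall t, 0 <= t * t :> R by move=> t; rewrite -expr2 sqr_ge0.
have K (t : R) : t * t = 0 -> t = 0 by move=> /eqP; rewrite mulf_eq0 orbb => /eqP.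
move: zz; rewrite /dotC => zz.
move: (H (re z 0)) (H (re z 1)) (H (re z 2)) (H (im z 0)) (H (im z 1)) (H (im z 2)).
by move=> ? ? ? ? ? ?; apply: C3P; rewrite !coordE; apply: K; lra.
Qed.

Lemma conj_crossDl z w a : conj_cross (z + w) a = conj_cross z a + conj_cross w a.
Proof. by rewrite /conj_cross; C3ring. Qed.

Lemma conj_crossZl s z a : conj_cross (s *: z) a = s *: conj_cross z a.
Proof. by rewrite /conj_cross; C3ring. Qed.

Lemma conj_cross_mulIl z w : conj_cross (mulI z) w = - mulI (conj_cross z w).
Proof. by rewrite /conj_cross /mulI; C3ring. Qed.

Lemma conj_cross_self z : conj_cross z z = 0.
Proof. by rewrite /conj_cross; C3ring. Qed.

Lemma dotC_conj_crossl z w : dotC (conj_cross z w) z = 0.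
Proof. by rewrite /dotC /conj_cross !coordE; ring. Qed.

Lemma dotC_conj_crossIl z w : dotC (conj_cross z w) (mulI z) = 0.
Proof. by rewrite /dotC /conj_cross /mulI !coordE; ring. Qed.

Lemma dotC_conj_crossIr z w : dotC (conj_cross z w) (mulI w) = 0.
Proof. by rewrite /dotC /conj_cross /mulI !coordE; ring. Qed.

Lemma dotC_conj_crossr z w : dotC (conj_cross z w) w = 0.
Proof. by rewrite /dotC /conj_cross !coordE; ring. Qed.

(** Lagrange's identity; the last two terms are the squared modulus of the
    Hermitian product of [z] and [w]. *)
Lemma dotC_conj_cross z w :
  dotC (conj_cross z w) (conj_cross z w) =
  dotC z z * dotC w w - dotC z w ^+ 2 - dotC z (mulI w) ^+ 2.
Proof. by rewrite /dotC /conj_cross /mulI !coordE; ring. Qed.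

Lemma conn_formDr a z w : conn_form a (z + w) = conn_form a z + conn_form a w.
Proof. by rewrite !conn_formE /conj_cross /re_cross; C3ring. Qed.

Lemma conn_formZr a s z : conn_form a (s *: z) = s *: conn_form a z.
Proof. by rewrite !conn_formE /conj_cross /re_cross; C3ring. Qed.

(** The antilinear part of the connection: the last term is (nabla_z J) w, which
    is what makes the structure nearly Kaehler and not Kaehler. *)
Lemma conn_form_mulI z w :
  conn_form z (mulI w) = mulI (conn_form z w) - (2 / 3) *: mulI (conj_cross z w).
Proof.
rewrite !conn_formE /conj_cross /re_cross /mulI.
by apply: C3P; rewrite !coordE; field.
Qed.

(** The connection is metric. *)
Lemma conn_form_skew z w a : dotC (conn_form z w) a + dotC w (conn_form z a) = 0.
Proof. by rewrite !conn_formE /conj_cross /re_cross /dotC !coordE; ring. Qed.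

(** The orthogonal projection on the complement of the complex line of [e]. *)
Definition normalC e z : C3 :=
  z - (dotC z e / dotC e e) *: e - (dotC z (mulI e) / dotC e e) *: mulI e.

Lemma normalCD e z w : normalC e (z + w) = normalC e z + normalC e w.
Proof. by rewrite /normalC !dotCDl; C3ring. Qed.

Lemma normalCZ e s z : normalC e (s *: z) = s *: normalC e z.
Proof. by rewrite /normalC !dotCZl; C3ring. Qed.

Lemma normalC_mulI e z : normalC e (mulI z) = mulI (normalC e z).
Proof.
rewrite /normalC !dotC_mulIl mulIK -[- e]scaleN1r dotCZr.
by rewrite !mulID !mulIN !mulIZ mulIK; C3ring.
Qed.

Lemma normalC_e e : e != 0 -> normalC e e = 0.
Proof.
move=> e0; rewrite /normalC dotC_mulI_self mul0r scale0r subr0.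
by rewrite divff ?dotC_eq0// scale1r subrr.
Qed.

Lemma normalC_id e z : dotC z e = 0 -> dotC z (mulI e) = 0 -> normalC e z = z.
Proof. by rewrite /normalC => -> ->; rewrite !mul0r !scale0r !subr0. Qed.

Lemma normalC_orth e z : e != 0 -> dotC (normalC e z) e = 0.
Proof.
move=> e0; rewrite /normalC !dotCDl !dotCNl !dotCZl [dotC (mulI e) e]dotCC.
by rewrite dotC_mulI_self mulr0 subr0 divfK ?dotC_eq0// subrr.
Qed.

Lemma normalC_orthI e z : e != 0 -> dotC (normalC e z) (mulI e) = 0.
Proof.
move=> e0; rewrite /normalC !dotCDl !dotCNl !dotCZl dotC_mulI.
by rewrite dotC_mulI_self mulr0 subr0 divfK ?dotC_eq0// subrr.
Qed.

Lemma normalC_comb e s t : e != 0 -> normalC e (s *: e + t *: mulI e) = 0.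
Proof.
move=> e0; rewrite normalCD !normalCZ normalC_mulI (normalC_e e0).
by rewrite mulI0 !scaler0 addr0.
Qed.

Lemma normalC_eq0 e z : normalC e z = 0 ->
  z = (dotC z e / dotC e e) *: e + (dotC z (mulI e) / dotC e e) *: mulI e.
Proof. by move=> /eqP; rewrite /normalC -addrA -opprD subr_eq0 => /eqP. Qed.

(** The left-hand side is the covariant derivative of the field s a + t i a,
    with [a' + g] that of [a]; the last term comes from the derivative of J. *)
Lemma comb_rearrange s s' t t' c a a' g q :
  s' *: a + s *: a' + (t' *: mulI a + t *: mulI a') +
    (s *: g + t *: (mulI g - c *: mulI q)) =
  s' *: a + t' *: mulI a + s *: (a' + g) + t *: mulI (a' + g) - (t * c) *: mulI q.
Proof. by rewrite /mulI; C3ring. Qed.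

Lemma dotC_combI e s t :
  dotC (s *: e + t *: mulI e) (mulI e) = t * dotC e e.
Proof. by rewrite dotCDl !dotCZl dotC_mulI_self dotC_mulI mulr0 add0r. Qed.

Definition complex_line a z : Prop := exists s t, z = s *: a + t *: mulI a.

Lemma complex_line_mulI a z : complex_line a z -> complex_line a (mulI z).
Proof.
by move=> [s [t ->]]; exists (- t), s; rewrite mulID !mulIZ mulIK scalerN scaleNr addrC.
Qed.

Lemma complex_lineZ a c z : complex_line a z -> complex_line a (c *: z).
Proof. by move=> [s [t ->]]; exists (c * s), (c * t); rewrite scalerDr !scalerA. Qed.

Lemma complex_lineD a z w : complex_line a z -> complex_line a w -> complex_line a (z + w).
Proof.
move=> [s [t ->]] [s' [t' ->]]; exists (s + s'), (t + t').
by rewrite !scalerDl addrACA.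
Qed.

Lemma complex_line_self a : complex_line a a.
Proof. by exists 1, 0; rewrite scale1r scale0r addr0. Qed.

Lemma complex_line0 z : complex_line 0 z -> z = 0.
Proof. by move=> [s [t ->]]; rewrite mulI0 !scaler0 addr0. Qed.

Lemma complex_lineN a z : complex_line a z -> complex_line a (- z).
Proof. by rewrite -scaleN1r; exact: complex_lineZ. Qed.

(** By orthogonality the product is zero, and Lagrange's identity then reads
    |e|^2 |a|^2 = 0. *)
Lemma conj_cross_complex_line e a : dotC a e = 0 -> dotC a (mulI e) = 0 ->
  complex_line a (conj_cross e a) -> e != 0 -> a = 0.
Proof.
move=> ae aIe [s [t E]] e0.
have := dotC_conj_cross e a; rewrite {2}E dotCDr !dotCZr dotC_conj_crossr.
rewrite dotC_conj_crossIr.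
rewrite [dotC e a]dotCC ae -[dotC e (mulI a)]opprK -dotC_mulIl.
rewrite [dotC (mulI e) a]dotCC aIe.
rewrite !mulr0 addr0 oppr0 expr0n/= !subr0 => /esym/eqP.
by rewrite mulf_eq0 !dotC_eq0 (negbTE e0)/= => /eqP.
Qed.

End HermitianSpace.

(** * Left translation on S^3 x S^3 *)

Section QuaternionCoordinates.
Variable R : realType.
Implicit Types x y z : quat R.

Lemma q0D x y : q0 (x + y) = q0 x + q0 y. Proof. by rewrite /q0 mxE. Qed.
Lemma q1D x y : q1 (x + y) = q1 x + q1 y. Proof. by rewrite /q1 mxE. Qed.
Lemma q2D x y : q2 (x + y) = q2 x + q2 y. Proof. by rewrite /q2 mxE. Qed.
Lemma q3D x y : q3 (x + y) = q3 x + q3 y. Proof. by rewrite /q3 mxE. Qed.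
Lemma q0N x : q0 (- x) = - q0 x. Proof. by rewrite /q0 mxE. Qed.
Lemma q1N x : q1 (- x) = - q1 x. Proof. by rewrite /q1 mxE. Qed.
Lemma q2N x : q2 (- x) = - q2 x. Proof. by rewrite /q2 mxE. Qed.
Lemma q3N x : q3 (- x) = - q3 x. Proof. by rewrite /q3 mxE. Qed.
Lemma q0Z s x : q0 (s *: x) = s * q0 x. Proof. by rewrite /q0 mxE. Qed.
Lemma q1Z s x : q1 (s *: x) = s * q1 x. Proof. by rewrite /q1 mxE. Qed.
Lemma q2Z s x : q2 (s *: x) = s * q2 x. Proof. by rewrite /q2 mxE. Qed.
Lemma q3Z s x : q3 (s *: x) = s * q3 x. Proof. by rewrite /q3 mxE. Qed.

Lemma mkquatE (a b c d : R) (z := mkquat a b c d) :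
  ((q0 z = a) * (q1 z = b) * (q2 z = c) * (q3 z = d))%type.
Proof. by rewrite /q0 /q1 /q2 /q3 !mxE !inordK. Qed.

Definition quatE := (q0D, q1D, q2D, q3D, q0N, q1N, q2N, q3N,
  q0Z, q1Z, q2Z, q3Z, mkquatE).

Lemma quatP x y : q0 x = q0 y -> q1 x = q1 y -> q2 x = q2 y -> q3 x = q3 y ->
  x = y.
Proof.
move=> h0 h1 h2 h3; apply/rowP => i; rewrite -[i]inord_val.
by case: i => [[|[|[|[|m]]]] im]/=.
Qed.

Lemma qdotE x y :
  qdot x y = q0 x * q0 y + q1 x * q1 y + q2 x * q2 y + q3 x * q3 y.
Proof.
rewrite /qdot !big_ord_recl big_ord0 addr0 !addrA /q0 /q1 /q2 /q3.
by do !congr (_ + _); congr (x _ _ * y _ _); apply/val_inj; rewrite /= ?inordK.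
Qed.

Lemma qmulDl x y z : qmul (x + y) z = qmul x z + qmul y z.
Proof. by rewrite /qmul; apply: quatP; rewrite !quatE; ring. Qed.

Lemma qmulDr x y z : qmul z (x + y) = qmul z x + qmul z y.
Proof. by rewrite /qmul; apply: quatP; rewrite !quatE; ring. Qed.

Lemma qmulZl s x z : qmul (s *: x) z = s *: qmul x z.
Proof. by rewrite /qmul; apply: quatP; rewrite !quatE; ring. Qed.

Lemma qmulZr s x z : qmul z (s *: x) = s *: qmul z x.
Proof. by rewrite /qmul; apply: quatP; rewrite !quatE; ring. Qed.

Lemma qmulNr x z : qmul z (- x) = - qmul z x.
Proof. by rewrite -scaleN1r qmulZr scaleN1r. Qed.

Lemma qmulA x y z : qmul x (qmul y z) = qmul (qmul x y) z.
Proof. by rewrite /qmul; apply: quatP; rewrite !quatE; ring. Qed.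

Lemma qmul_conjK x y : qmul (qconj x) (qmul x y) = qdot x x *: y.
Proof. by rewrite /qmul /qconj qdotE; apply: quatP; rewrite !quatE; ring. Qed.

Lemma qmulK_conj x y : qmul x (qmul (qconj x) y) = qdot x x *: y.
Proof. by rewrite /qmul /qconj qdotE; apply: quatP; rewrite !quatE; ring. Qed.

Lemma qmul_invK x y : qdot x x != 0 -> qmul (qinv x) (qmul x y) = y.
Proof.
by move=> x0; rewrite /qinv qmulZl qmul_conjK scalerA mulVf// scale1r.
Qed.

Lemma qdot_qmul x y z : qdot (qmul x y) (qmul x z) = qdot x x * qdot y z.
Proof. by rewrite !qdotE /qmul !quatE; ring. Qed.

Lemma q0_qmul_conj x y : q0 (qmul (qconj x) y) = qdot x y.
Proof. by rewrite qdotE /qmul /qconj !quatE; ring. Qed.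

End QuaternionCoordinates.

Section LeftTrivialisation.
Variable R : realType.
Local Notation H := (quat R).
Local Notation C3 := 'rV[R]_6.
Implicit Types (p Z : H * H) (z w : C3).

Local Notation r3 := (Num.sqrt 3 : R).
Local Notation k := (r3 / 3).

Lemma sqrt3_sq : r3 * r3 = 3.
Proof. by rewrite -expr2 sqr_sqrtr. Qed.

Lemma sqrt3V : r3^-1 = k.
Proof.
by rewrite -[X in _ / X]sqrt3_sq invfM mulrA divff ?mul1r// sqrtr_eq0 -ltNge.
Qed.

(** The imaginary quaternions (a, b) attached to z = x + i y: the real and
    imaginary parts of conj(omega) a + omega b, omega = exp(2 i pi / 3), are
    x = - (a + b) / 2 and y = sqrt 3 (b - a) / 2. *)
Definition angle1 z : H := mkquat 0 (- re z 0 - k * im z 0)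
  (- re z 1 - k * im z 1) (- re z 2 - k * im z 2).
Definition angle2 z : H := mkquat 0 (- re z 0 + k * im z 0)
  (- re z 1 + k * im z 1) (- re z 2 + k * im z 2).

Definition translate p z : H * H := (qmul p.1 (angle1 z), qmul p.2 (angle2 z)).

Definition untranslate p Z : C3 :=
  let a := qmul (qconj p.1) Z.1 in let b := qmul (qconj p.2) Z.2 in
  let r s t := - 2^-1 * (s + t) in let m s t := r3 / 2 * (t - s) in
  mkC3 (r (q1 a) (q1 b)) (r (q2 a) (q2 b)) (r (q3 a) (q3 b))
       (m (q1 a) (q1 b)) (m (q2 a) (q2 b)) (m (q3 a) (q3 b)).

Lemma pair_add (V W : nmodType) (a c : V) (b d : W) :
  (a, b) + (c, d) = (a + c, b + d).
Proof. by []. Qed.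

Lemma pair_scale (V W : lmodType R) s (a : V) (b : W) :
  s *: (a, b) = (s *: a, s *: b).
Proof. by []. Qed.

Lemma pair_opp (V W : zmodType) (a : V) (b : W) : - (a, b) = (- a, - b).
Proof. by []. Qed.

Definition pairE := (pair_add, pair_opp, pair_scale).

Lemma translate_linear p : linear (translate p).
Proof.
move=> s z w; rewrite /translate !pairE -!qmulZr -!qmulDr.
by congr (qmul _ _, qmul _ _); rewrite /angle1 /angle2; apply: quatP;
  rewrite !quatE ?coordE; ring.
Qed.

Lemma translate_linearl z : linear (translate^~ z).
Proof. by move=> s p q; rewrite /translate/= !pairE !qmulDl !qmulZl. Qed.

Lemma translateD p z w : translate p (z + w) = translate p z + translate p w.
Proof. by rewrite -[z]scale1r translate_linear !scale1r. Qed.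

Lemma translate0 p : translate p 0 = 0.
Proof. by have := translate_linear p (-1) 0 0; rewrite scaler0 addr0 scaleN1r addNr. Qed.

Lemma translateZ p s z : translate p (s *: z) = s *: translate p z.
Proof. by rewrite -[s *: z]addr0 translate_linear translate0 addr0. Qed.

Lemma translateB p z w : translate p (z - w) = translate p z - translate p w.
Proof. by rewrite -scaleN1r translateD translateZ scaleN1r. Qed.

Lemma translate_tangent p z : TS3S3 p (translate p z).
Proof.
by split; rewrite qdotE /translate /qmul /angle1 /angle2 /= !quatE; ring.
Qed.

Lemma untranslateK p Z : S3S3 p -> TS3S3 p Z -> translate p (untranslate p Z) = Z.
Proof.
case: p Z => [p q] [U V] [/= p1 q1_] [/= pU qV]; rewrite /translate /untranslate /=.
have a0 : q0 (qmul (qconj p) U) = 0 by rewrite q0_qmul_conj.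
have b0 : q0 (qmul (qconj q) V) = 0 by rewrite q0_qmul_conj.
have Ua : U = qmul p (qmul (qconj p) U) by rewrite qmulK_conj p1 scale1r.
have Vb : V = qmul q (qmul (qconj q) V) by rewrite qmulK_conj q1_ scale1r.
rewrite [in RHS]Ua [in RHS]Vb {Ua Vb}.
move: (qmul (qconj p) U) (qmul (qconj q) V) a0 b0 => a b a0 b0.
have k2 := sqrt3_sq.
by congr (qmul _ _, qmul _ _); rewrite /angle1 /angle2; apply: quatP;
  rewrite !quatE ?a0 ?b0// ?coordE; field: k2.
Qed.

Lemma translateK p z : S3S3 p -> untranslate p (translate p z) = z.
Proof.
case: p => [p q] [/= p1 q1_]; rewrite /untranslate /translate /= !qmul_conjK p1 q1_ !scale1r.
have k2 := sqrt3_sq.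
by rewrite /angle1 /angle2; apply: C3P; rewrite !coordE !quatE; field: k2.
Qed.

(** This holds off S^3 x S^3 as well, which matters below because directional
    derivatives leave the submanifold. *)
Lemma nkJ_translate p z : qdot p.1 p.1 != 0 -> qdot p.2 p.2 != 0 ->
  nkJ p (translate p z) = translate p (mulI z).
Proof.
case: p => [p q] /= p0 q0_; rewrite /nkJ /translate /= -!qmulA !qmul_invK// sqrt3V.
have k2 := sqrt3_sq.
have -> : angle1 (mulI z) = k *: (2 *: angle2 z - angle1 z).
  by rewrite /angle1 /angle2; apply: quatP; rewrite !quatE ?coordE; field: k2.
have -> : angle2 (mulI z) = k *: (- (2 *: angle1 z) + angle2 z).
  by rewrite /angle1 /angle2; apply: quatP; rewrite !quatE ?coordE; field: k2.
by rewrite pair_scale !(qmulZr, qmulDr, qmulNr).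
Qed.

Lemma nk_metric_translate p z w : qdot p.1 p.1 != 0 -> qdot p.2 p.2 != 0 ->
  nk_metric p (translate p z) (translate p w) =
  2 / 3 * (qdot p.1 p.1 + qdot p.2 p.2) * dotC z w.
Proof.
move=> p0 q0_; rewrite /nk_metric !nkJ_translate// /dot_prod /translate/= !qdot_qmul.
set P := qdot p.1 p.1; set Q := qdot p.2 p.2.
have k2 := sqrt3_sq.
by rewrite !qdotE /angle1 /angle2 /dotC !quatE ?coordE; field: k2.
Qed.

Lemma angle1_bracket z w : angle1 (conn_form z w - conn_form w z) =
  qmul (angle1 z) (angle1 w) - qmul (angle1 w) (angle1 z).
Proof.
have k2 := sqrt3_sq.
rewrite !conn_formE /angle1 /conj_cross /re_cross /qmul.
by apply: quatP; rewrite !quatE ?coordE; field: k2.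
Qed.

Lemma angle2_bracket z w : angle2 (conn_form z w - conn_form w z) =
  qmul (angle2 z) (angle2 w) - qmul (angle2 w) (angle2 z).
Proof.
have k2 := sqrt3_sq.
rewrite !conn_formE /angle2 /conj_cross /re_cross /qmul.
by apply: quatP; rewrite !quatE ?coordE; field: k2.
Qed.

(** For fixed [w], the map [translate^~ w] is a linear left-invariant field;
    the left-hand side is the bracket of two of them. *)
Lemma translate_bracket p z w :
  translate (translate p z) w - translate (translate p w) z = translate p (conn_form z w - conn_form w z).
Proof.
apply: injective_projections; rewrite /translate/= -!qmulA.
  by rewrite angle1_bracket qmulDr qmulNr.
by rewrite angle2_bracket qmulDr qmulNr.
Qed.

End LeftTrivialisation.

(** * The Levi-Civita connection of the nearly Kaehler metric *)

Section NearlyKaehlerConnection.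
Variable R : realType.
Local Notation H := (quat R).
Local Notation C3 := 'rV[R]_6.
Implicit Types (p Z : H * H) (z w : C3).

Lemma qmul_continuousl (m : H) : continuous (fun x : H => qmul x m).
Proof.
have lm : linear (fun x : H => qmul x m).
  by move=> s x y; rewrite qmulDl qmulZl.
pose L := GRing.isLinear.Build _ _ _ _ _ lm.
pose l : {linear H -> H} := HB.pack (fun x : H => qmul x m) L.
exact: (@linear_rV_continuous _ _ _ l).
Qed.

Lemma translate_continuous z : continuous (fun p : H * H => translate p z).
Proof.
move=> p.
have c1 : qmul x.1 (angle1 z) @[x --> p] --> qmul p.1 (angle1 z).
  exact: (cvg_comp fst (fun x : H => qmul x (angle1 z)) cvg_fst
    (@qmul_continuousl (angle1 z) p.1)).
have c2 : qmul x.2 (angle2 z) @[x --> p] --> qmul p.2 (angle2 z).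
  exact: (cvg_comp snd (fun x : H => qmul x (angle2 z)) cvg_snd
    (@qmul_continuousl (angle2 z) p.2)).
exact: (cvg_pair c1 c2).
Qed.

Definition translate_at z p : H * H := translate p z.
HB.instance Definition _ z := GRing.isLinear.Build R (H * H)%type (H * H)%type
  *:%R (translate_at z) (@translate_linearl R z).

Lemma derive_translate_cst p Z w : 'D_Z (fun p : H * H => translate p w) p = translate Z w.
Proof.
have dI : differentiable (id : H * H -> H * H) p by exact: ex_diff.
have := @derive_lin R (H * H)%type (H * H)%type (H * H)%type (translate_at w) id Z p
  (@translate_continuous w) dI.
by rewrite derive_id.
Qed.

Lemma vector_field_translate w : vector_field (@S3S3 R) (@TS3S3 R) (fun p => translate p w).
Proof.
split; last by move=> p _; exact: translate_tangent.
exists setT; split => //; first exact: openT.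
apply: (@smooth_lin _ _ _ openT _ _ (translate_at w) id (@translate_continuous w)).
exact: smooth_id openT.
Qed.

(** The metric of two left-invariant fields depends on (p, q) only through
    |p|^2 + |q|^2, which is constant to first order along tangent vectors. *)
Lemma derive_nk_metric_translate p Z z w : S3S3 p -> TS3S3 p Z ->
  'D_Z (fun p => nk_metric p (translate p z) (translate p w)) p = 0.
Proof.
move=> [p1 p2] [Z1 Z2].
have qdotDZ (x y : H) h : qdot x x = 1 -> qdot x y = 0 ->
    qdot (h *: y + x) (h *: y + x) = 1 + h ^+ 2 * qdot y y.
  move=> xx xy; transitivity (qdot x x + 2 * h * qdot x y + h ^+ 2 * qdot y y).
    by rewrite !qdotE !quatE; ring.
  by rewrite xx xy mulr0 addr0.
have qdot_ge0 (y : H) : 0 <= qdot y y.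
  by rewrite qdotE -!expr2 !addr_ge0 ?sqr_ge0.
have pos (y : H) h : 0 < 1 + h ^+ 2 * qdot y y.
  by rewrite ltr_pwDl// mulr_ge0 ?sqr_ge0.
pose c := 2 / 3 * (qdot Z.1 Z.1 + qdot Z.2 Z.2) * dotC z w.
rewrite /derive.
have -> : (fun h : R => h^-1 *: (((fun p => nk_metric p (translate p z) (translate p w))
    \o shift p) (h *: Z) - nk_metric p (translate p z) (translate p w))) =
    (fun h : R => h^-1 * (h * (h * c))).
  apply/funext => h /=; rewrite -[LHS]/(_ * _); congr (_ * _).
  rewrite !nk_metric_translate /= ?qdotDZ ?p1 ?p2 ?oner_eq0 ?gt_eqF//.
  by rewrite /c; field.
apply: cvg_lim => //.
have : h * c @[h --> (0 : R)] --> 0 * c by apply: cvgM; [exact: cvg_id|exact: cvg_cst].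
rewrite mul0r => H0.
have H1 : h * c @[h --> (0 : R)^'] --> 0.
  by apply: cvg_trans H0; apply: cvg_app; exact: cvg_within.
apply: cvg_trans H1; apply: near_eq_cvg; near=> h.
by rewrite mulKf//; near: h; exact: nbhs_dnbhs_neq.
Unshelve. all: by end_near. Qed.

(** The uniqueness in Koszul's theorem: the difference of two solutions is
    symmetric in its first two slots and skew in the last two, hence zero. *)
Lemma conn_form_unique (C : C3 -> C3 -> C3) :
  (forall z w, C z w - C w z = conn_form z w - conn_form w z) ->
  (forall z w a, dotC (C z w) a + dotC w (C z a) = 0) ->
  forall z w, C z w = conn_form z w.
Proof.
move=> Csym Cskew z w; pose T z w a := dotC (C z w) a - dotC (conn_form z w) a.
have Ts x y a : T x y a = T y x a.
  have /(congr1 (fun b => dotC b a)) := Csym x y.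
  by rewrite /= (dotCBl (C x y)) (dotCBl (conn_form x y)) /T => E; lra.
have Tk x y a : T x y a = - T x a y.
  have := Cskew x y a; have := conn_form_skew x y a.
  by rewrite /T ![dotC y _]dotCC => E1 E2; lra.
have T0 x y a : T x y a = 0.
  have := Tk x y a; rewrite (Ts x a) (Tk a x y) (Ts a y) (Tk y a x) (Ts y x).
  by move=> E; lra.
apply/eqP; rewrite -subr_eq0 -dotC_eq0 dotCBl.
by apply/eqP; exact: T0.
Qed.

Variable D : H * H -> H * H -> H * H -> H * H.
Hypothesis HD : nk_levi_civita D.

(** The axioms of the Levi-Civita connection, applied to left-invariant fields;
    the subtracted term is the flat derivative of such a field. *)
Lemma nk_connection_translate p z w : S3S3 p ->
  D p (translate p z) (translate p w) = translate p (conn_form z w) - translate (translate p z) w.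
Proof.
move=> Sp; have [[_ Dtan] Dtors Dmet] := HD.
pose X x (p' : H * H) : H * H := translate p' x.
have X_field x : vector_field (@S3S3 R) (@TS3S3 R) (X x) by exact: vector_field_translate.
pose C x y := untranslate p (cov D (X x) (X y) p).
have CE x y : cov D (X x) (X y) p = translate p (C x y).
  by rewrite untranslateK//; apply: Dtan.
have [p1 p2] := Sp.
have metE x y : nk_metric p (translate p x) (translate p y) = 4 / 3 * dotC x y.
  by rewrite nk_metric_translate ?p1 ?p2 ?oner_eq0//; field.
have CG : forall x y, C x y = conn_form x y.
  apply: conn_form_unique => [x y|x y a].
    have := Dtors _ _ (X_field x) (X_field y) p Sp.
    rewrite !CE !derive_translate_cst translate_bracket -translateB.
    by move=> /(congr1 (untranslate p)); rewrite !translateK.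
  have := Dmet _ _ _ (X_field x) (X_field y) (X_field a) p Sp.
  rewrite derive_nk_metric_translate//; last exact: translate_tangent.
  by rewrite !CE !metE; lra.
have := CE z w; rewrite CG /cov derive_translate_cst => <-.
by rewrite addrAC subrr add0r.
Qed.

Lemma nk_connection_sym p (z w : C3) : S3S3 p ->
  D p (translate p z) (translate p w) = D p (translate p w) (translate p z).
Proof.
move=> Sp; rewrite !nk_connection_translate//.
have /eqP := translate_bracket p z w; rewrite (translateB p (conn_form z w)) subr_eq => /eqP ->.
rewrite opprD opprB addrA; congr (_ - _).
by rewrite addrC subrK.
Qed.

End NearlyKaehlerConnection.

(** * Smooth vector fields in C^3 *)

Section SmoothC3.
Variables (R : realType) (E : normedModType R) (W : set E).
Hypothesis openW : open W.
Local Notation C3 := 'rV[R]_6.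
Implicit Types (a b : E -> C3) (s t : E -> R).

Lemma smooth_re a k : smooth_on W a -> smooth_on W (fun y => re (a y) k).
Proof. exact: smooth_coord. Qed.

Lemma smooth_im a k : smooth_on W a -> smooth_on W (fun y => im (a y) k).
Proof. exact: smooth_coord. Qed.

Lemma smooth_mkC3 (x0 x1 x2 y0 y1 y2 : E -> R) :
  smooth_on W x0 -> smooth_on W x1 -> smooth_on W x2 ->
  smooth_on W y0 -> smooth_on W y1 -> smooth_on W y2 ->
  smooth_on W (fun y => mkC3 (x0 y) (x1 y) (x2 y) (y0 y) (y1 y) (y2 y)).
Proof.
move=> sx0 sx1 sx2 sy0 sy1 sy2; apply: smooth_rV => // i.
case: i => [[|[|[|[|[|[|m]]]]]] im]//.
- by apply: (smooth_eq openW _ sx0) => y _; rewrite mxE.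
- by apply: (smooth_eq openW _ sx1) => y _; rewrite mxE.
- by apply: (smooth_eq openW _ sx2) => y _; rewrite mxE.
- by apply: (smooth_eq openW _ sy0) => y _; rewrite mxE.
- by apply: (smooth_eq openW _ sy1) => y _; rewrite mxE.
- by apply: (smooth_eq openW _ sy2) => y _; rewrite mxE.
Qed.

Ltac smooth := repeat (first [assumption | apply: smooth_mkC3 |
  apply: smoothB => // | apply: smoothN => // |
  apply: smoothD => // | apply: smoothM => // | apply: smooth_re |
  apply: smooth_im | apply: smooth_cst => //]).

Lemma smooth_mulI a : smooth_on W a -> smooth_on W (fun y => mulI (a y)).
Proof. by move=> sa; rewrite /mulI; smooth. Qed.

Lemma smooth_dotC a b : smooth_on W a -> smooth_on W b ->
  smooth_on W (fun y => dotC (a y) (b y)).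
Proof. by move=> sa sb; rewrite /dotC; smooth. Qed.

Lemma smooth_scale s a : smooth_on W s -> smooth_on W a ->
  smooth_on W (fun y => s y *: a y).
Proof.
move=> ss sa; apply: smooth_rV => // i.
have := smoothM openW ss (smooth_coord i openW sa).
by apply: smooth_eq => // y _; rewrite mxE.
Qed.

Lemma smooth_conn_form a b : smooth_on W a -> smooth_on W b ->
  smooth_on W (fun y => conn_form (a y) (b y)).
Proof.
move=> sa sb; apply: (smooth_eq openW (fun y _ => esym (conn_formE (a y) (b y)))).
apply: smoothD => //.
  by apply: smooth_scale; rewrite /conj_cross; smooth.
have : smooth_on W (fun y => (- (4 / 3)) *: re_cross (a y) (b y)).
  by apply: smooth_scale; rewrite /re_cross; smooth.
by apply: smooth_eq => // y _; rewrite scaleNr.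
Qed.

Lemma smooth_normalC a b : (forall y, W y -> a y != 0) ->
  smooth_on W a -> smooth_on W b -> smooth_on W (fun y => normalC (a y) (b y)).
Proof.
move=> a0 sa sb; have saI := smooth_mulI sa.
have sV : smooth_on W (fun y => (dotC (a y) (a y))^-1).
  by apply: smoothV => // [y Wy|]; [rewrite dotC_eq0 a0|exact: smooth_dotC].
have st c : smooth_on W c ->
    smooth_on W (fun y => - ((dotC (b y) (c y) / dotC (a y) (a y)) *: c y)).
  move=> sc; have : smooth_on W (fun y => (- (dotC (b y) (c y) / dotC (a y) (a y))) *: c y).
    apply: smooth_scale => //; apply: smoothN => //; apply: smoothM => //.
    exact: smooth_dotC.
  by apply: smooth_eq => // y _; rewrite scaleNr.
by rewrite /normalC; apply: smoothD => //; [apply: smoothD => //|]; exact: st.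
Qed.

Lemma derive_mulI a y v : differentiable a y ->
  'D_v (fun y => mulI (a y)) y = mulI ('D_v a y).
Proof.
move=> da; have lI : linear (@mulI R) by move=> s z w; rewrite mulID mulIZ.
pose L := GRing.isLinear.Build _ _ _ _ _ lI.
pose l : {linear C3 -> C3} := HB.pack (@mulI R) L.
exact: (@derive_lin R E _ _ l a v y (@linear_rV_continuous _ _ _ l)).
Qed.

Lemma derive_comb s t a y v : smooth_on W s -> smooth_on W t -> smooth_on W a ->
  W y -> 'D_v (fun y => s y *: a y + t y *: mulI (a y)) y =
  'D_v s y *: a y + s y *: 'D_v a y +
  ('D_v t y *: mulI (a y) + t y *: mulI ('D_v a y)).
Proof.
move=> ss st sa Wy; have saI := smooth_mulI sa.
have d1 := derive_scale (smooth_derivable (v := v) ss Wy) (smooth_derivable (v := v) sa Wy)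
  (differentiable_continuous (smooth_diff sa Wy)).
have d2 := derive_scale (smooth_derivable (v := v) st Wy) (smooth_derivable (v := v) saI Wy)
  (differentiable_continuous (smooth_diff saI Wy)).
have := is_deriveD d1 d2 => d; rewrite -derive_mulI; last exact: smooth_diff sa Wy.
by rewrite -[RHS]derive_val.
Qed.

End SmoothC3.

(** * Almost complex surfaces in a chart *)

Lemma rV2P (R : realType) (u v : 'rV[R]_2) :
  u 0 0 = v 0 0 -> u 0 1 = v 0 1 -> u = v.
Proof.
move=> h0 h1; apply/rowP => i.
have [->|->] // : i = 0 \/ i = 1.
by case: i => [[|[|i]] Hi] //; [left|right]; exact: val_inj.
Qed.

(** The velocity of [phi] in the direction [v], in left-translated coordinates.
    It is sealed so that two frames are never compared by unfolding derivatives. *)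
HB.lock Definition moving_frame (R : realType)
    (phi : 'rV[R]_2 -> quat R * quat R) (v y : 'rV[R]_2) : 'rV[R]_6 :=
  untranslate (phi y) ('D_v phi y).

Section ImmersedChart.
Variable R : realType.
Local Notation H := (quat R).
Local Notation C3 := 'rV[R]_6.
Local Notation E := 'rV[R]_2.
Variables (W : set E) (phi : E -> H * H).
Hypothesis openW : open W.
Hypothesis phiS : forall y, W y -> S3S3 (phi y).
Hypothesis smooth_phi : smooth_on W phi.
Hypothesis phi_imm : forall y, W y -> forall v, 'D_v phi y = 0 -> v = 0.
Hypothesis phi_J : forall y, W y ->
  nkJ (phi y) @` tangent_plane phi y = tangent_plane phi y.
Variable D : H * H -> H * H -> H * H -> H * H.
Hypothesis HD : nk_levi_civita D.
Implicit Types (u v w x y : E).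

Local Notation frame := (moving_frame phi).

Lemma qdot_derive (P : E -> H) y v : smooth_on W P ->
  (forall y, W y -> qdot (P y) (P y) = 1) -> W y -> qdot (P y) ('D_v P y) = 0.
Proof.
move=> sP P1 Wy.
have lB1 (p : H) : linear (qdot p : H -> R).
  by move=> s z w; rewrite -[_ *: qdot _ _]/(_ * _) !qdotE !quatE; ring.
have lB2 (z : H) : linear ((@qdot R)^~ z : H -> R).
  by move=> s p q; rewrite -[_ *: qdot _ _]/(_ * _) !qdotE !quatE; ring.
have cB (z : H) : continuous ((@qdot R)^~ z : H -> R).
  pose L := GRing.isLinear.Build _ _ _ _ _ (lB2 z).
  pose l : {linear H -> R} := HB.pack ((@qdot R)^~ z) L.
  exact: (@linear_rV_continuous _ _ _ l).
have dP := smooth_diff sP Wy.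
have := derive_bilinear lB1 lB2 cB dP (diff_derivable (v := v) dP).
move=> /@derive_val; rewrite (derive_eq_on openW (g := fun=> (1 : R)) v P1 Wy).
rewrite derive_cst => /eqP; rewrite eq_sym.
by rewrite !qdotE => /eqP h; lra.
Qed.

Lemma velocity_tangent v y : W y -> TS3S3 (phi y) ('D_v phi y).
Proof.
move=> Wy; split.
  rewrite -derive_fst; last exact: smooth_diff smooth_phi Wy.
  by apply: (@qdot_derive _ y v (smooth_fst openW smooth_phi)) => // z /phiS [].
rewrite -derive_snd; last exact: smooth_diff smooth_phi Wy.
by apply: (@qdot_derive _ y v (smooth_snd openW smooth_phi)) => // z /phiS [].
Qed.

Lemma velocityE v y : W y -> 'D_v phi y = translate (phi y) (frame v y).
Proof.
move=> Wy; rewrite moving_frame.unlock untranslateK//; first exact: phiS.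
exact: velocity_tangent.
Qed.

Lemma translate_inj y (z z' : C3) : W y -> translate (phi y) z = translate (phi y) z' -> z = z'.
Proof. by move=> /phiS Sy /(congr1 (untranslate (phi y))); rewrite !translateK. Qed.

Lemma frame_linear y : W y -> linear (frame^~ y).
Proof.
move=> Wy s v w; have df := smooth_diff smooth_phi Wy.
have e : 'D_(s *: v + w) phi y = s *: 'D_v phi y + 'D_w phi y.
  by rewrite (deriveE _ df) (deriveE v df) (deriveE w df) linearP.
have E := translate_linear (phi y) s (frame v y) (frame w y).
apply: (translate_inj Wy); refine (etrans (esym (velocityE _ Wy)) (etrans e _)).
refine (etrans _ (esym E)).
exact: (congr2 (fun a b => s *: a + b) (velocityE v Wy) (velocityE w Wy)).
Qed.

Lemma frame_eq0 v y : W y -> frame v y = 0 -> v = 0.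
Proof. by move=> Wy f0; apply: (phi_imm Wy); rewrite velocityE// f0 translate0. Qed.

Lemma frameD v w y : W y -> frame (v + w) y = frame v y + frame w y.
Proof. by move=> Wy; have := frame_linear Wy 1 v w; rewrite !scale1r. Qed.

Lemma frame0 y : W y -> frame 0 y = 0.
Proof.
move=> Wy; have := frame_linear Wy (-1) 0 0; rewrite scaleN1r oppr0 addr0 => ->.
by rewrite scaleN1r addNr.
Qed.

Lemma frameZ s v y : W y -> frame (s *: v) y = s *: frame v y.
Proof.
by move=> Wy; have := frame_linear Wy s v 0; rewrite addr0 (frame0 Wy) addr0.
Qed.

Ltac smooth := repeat (first [assumption | apply: smooth_mkC3 => // |
  apply: smoothB => // | apply: smoothN => // |
  apply: smoothD => // | apply: smoothM => // | apply: smooth_coord => // |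
  apply: smooth_cst => //]).

Lemma smooth_frame v : smooth_on W (frame v).
Proof.
have sP := smooth_fst openW smooth_phi; have sQ := smooth_snd openW smooth_phi.
have sdP := smooth_fst openW (smooth_derive v smooth_phi).
have sdQ := smooth_snd openW (smooth_derive v smooth_phi).
apply: (smooth_eq openW (f := fun y => untranslate (phi y) ('D_v phi y))).
  by move=> y _; rewrite moving_frame.unlock.
rewrite /untranslate.
suff sc (P Q : E -> H) : smooth_on W P -> smooth_on W Q ->
    [/\ smooth_on W (fun y => q1 (qmul (qconj (P y)) (Q y))),
        smooth_on W (fun y => q2 (qmul (qconj (P y)) (Q y))) &
        smooth_on W (fun y => q3 (qmul (qconj (P y)) (Q y)))].
  have [? ? ?] := sc _ _ sP sdP; have [? ? ?] := sc _ _ sQ sdQ.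
  by smooth.
move=> {sP sdP sQ sdQ} sP sQ; split.
- apply: (smooth_eq openW (f := fun y => q0 (P y) * q1 (Q y) + - q1 (P y) * q0 (Q y) +
    - q2 (P y) * q3 (Q y) - - q3 (P y) * q2 (Q y))).
    by move=> y _; rewrite /qmul /qconj !quatE.
  by rewrite /q0 /q1 /q2 /q3; smooth.
- apply: (smooth_eq openW (f := fun y => q0 (P y) * q2 (Q y) - - q1 (P y) * q3 (Q y) +
    - q2 (P y) * q0 (Q y) + - q3 (P y) * q1 (Q y))).
    by move=> y _; rewrite /qmul /qconj !quatE.
  by rewrite /q0 /q1 /q2 /q3; smooth.
- apply: (smooth_eq openW (f := fun y => q0 (P y) * q3 (Q y) + - q1 (P y) * q2 (Q y) -
    - q2 (P y) * q1 (Q y) + - q3 (P y) * q0 (Q y))).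
    by move=> y _; rewrite /qmul /qconj !quatE.
  by rewrite /q0 /q1 /q2 /q3; smooth.
Qed.

Lemma cov_along_translate (X : E -> E) (xi : E -> H * H) (a : E -> C3) y : W y ->
  smooth_on W a -> (forall y, W y -> xi y = translate (phi y) (a y)) ->
  cov_along phi D X xi y =
  translate (phi y) ('D_(X y) a y + conn_form (frame (X y) y) (a y)).
Proof.
move=> Wy sa xia; rewrite /cov_along (derive_eq_on openW _ xia Wy) xia//.
rewrite /push velocityE// nk_connection_translate//; last exact: phiS.
have := derive_bilinear (@translate_linear R) (@translate_linearl R) (@translate_continuous R)
  (smooth_diff smooth_phi Wy) (smooth_derivable (v := X y) sa Wy).
move=> /@derive_val ->; rewrite (velocityE (X y) Wy) [in RHS]translateD.
by rewrite addrC addrA subrK addrC.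
Qed.

Definition covariant v (a : E -> C3) y : C3 :=
  'D_v a y + conn_form (frame v y) (a y).

(** The connection has no torsion and the second derivatives of [phi] commute. *)
Lemma covariant_sym v w y : W y ->
  covariant v (frame w) y = covariant w (frame v) y.
Proof.
move=> Wy; apply: (translate_inj Wy).
have c v' w' : translate (phi y) (covariant v' (frame w') y) =
    'D_v' ('D_w' phi) y +
    D (phi y) (translate (phi y) (frame v' y)) (translate (phi y) (frame w' y)).
  have := @cov_along_translate (fun=> v') ('D_w' phi) (frame w') y Wy (smooth_frame w')
    (fun y Wy => velocityE w' Wy).
  by rewrite /covariant => <-; rewrite /cov_along /push !velocityE.
refine (etrans (c v w) (etrans _ (esym (c w v)))).
refine (congr2 +%R _ (nk_connection_sym HD (frame v y) (frame w y) (phiS Wy))).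
have sD u := smooth_derive u smooth_phi.
have dD u z : W z -> differentiable ('D_u phi) z.
  by move=> Wz; exact: smooth_diff (sD u) Wz.
have d0 z : W z -> differentiable phi z by exact: smooth_diff.
have first_eq v' w' : 'D_v' (fun z => ('D_w' phi z).1) y =
    'D_v' ('D_w' (fun z => (phi z).1)) y.
  exact: (derive_eq_on openW v'
    (fun z Wz => esym (derive_fst w' (d0 z Wz))) Wy).
have second_eq v' w' : 'D_v' (fun z => ('D_w' phi z).2) y =
    'D_v' ('D_w' (fun z => (phi z).2)) y.
  exact: (derive_eq_on openW v'
    (fun z Wz => esym (derive_snd w' (d0 z Wz))) Wy).
apply: injective_projections.
- refine (etrans (esym (derive_fst v (dD w y Wy))) _).
  refine (etrans _ (derive_fst w (dD v y Wy))).
  refine (etrans (first_eq v w) (etrans _ (esym (first_eq w v)))).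
  exact: (derive_comm_rV openW v w (smooth_fst openW smooth_phi) Wy).
- refine (etrans (esym (derive_snd v (dD w y Wy))) _).
  refine (etrans _ (derive_snd w (dD v y Wy))).
  refine (etrans (second_eq v w) (etrans _ (esym (second_eq w v)))).
  exact: (derive_comm_rV openW v w (smooth_snd openW smooth_phi) Wy).
Qed.

Lemma metric_frame y (z z' : C3) : W y ->
  nk_metric (phi y) (translate (phi y) z) (translate (phi y) z') = 4 / 3 * dotC z z'.
Proof.
move=> /phiS [p1 p2]; rewrite nk_metric_translate ?p1 ?p2 ?oner_eq0//.
by congr (_ * _); field.
Qed.

Lemma J_frame v y : W y -> exists w, frame w y = mulI (frame v y).
Proof.
move=> Wy; have [p1 p2] := phiS Wy.
have : (nkJ (phi y) @` tangent_plane phi y) (nkJ (phi y) ('D_v phi y)).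
  by exists ('D_v phi y) => //; exists v.
rewrite phi_J// => -[w _ E]; exists w; apply: (translate_inj Wy).
refine (etrans (esym (velocityE w Wy)) (etrans E _)).
rewrite (velocityE v Wy); apply: nkJ_translate; rewrite ?p1 ?p2 oner_eq0//.
Qed.

Lemma frame_neq0 u y : W y -> u != 0 -> frame u y != 0.
Proof. by move=> Wy u0; apply/eqP => /(frame_eq0 Wy) /eqP; apply/negP. Qed.

(** The tangent plane is the complex line of any of its nonzero vectors: the
    direction [w] with frame w = i frame u is independent of [u], hence every
    [v] is a combination of the two, by Cramer's rule. *)
Lemma normalC_frame u v y : W y -> u != 0 ->
  normalC (frame u y) (frame v y) = 0.
Proof.
move=> Wy u0; have [w Jw] := J_frame u Wy; have e0 := frame_neq0 Wy u0.
pose d := u 0 0 * w 0 1 - u 0 1 * w 0 0.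
have cramer v' : d *: v' = (v' 0 0 * w 0 1 - v' 0 1 * w 0 0) *: u +
    (u 0 0 * v' 0 1 - u 0 1 * v' 0 0) *: w.
  by apply: rV2P; rewrite !mxE /d; ring.
have frameE v' : d *: frame v' y =
    (v' 0 0 * w 0 1 - v' 0 1 * w 0 0) *: frame u y +
    (u 0 0 * v' 0 1 - u 0 1 * v' 0 0) *: mulI (frame u y).
  rewrite -(frameZ d v' Wy) cramer (frameD _ _ Wy).
  by rewrite (frameZ _ u Wy) (frameZ _ w Wy) Jw.
have d0 : d != 0.
  apply/eqP => d0; have Z v' : u 0 0 * v' 0 1 - u 0 1 * v' 0 0 = 0.
    have := frameE v'; rewrite d0 scale0r.
    move=> /(congr1 (fun z => dotC z (mulI (frame u y)))).
    rewrite dotC_combI dotC0l => /esym/eqP; rewrite mulf_eq0 dotC_eq0 (negbTE e0) orbF.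
    by move=> /eqP.
  (* By [Z], u is parallel to both basis vectors. *)
  have := Z 'e_0; have := Z 'e_1; rewrite !mxE/= !mulr1 !mulr0 subr0 sub0r => u00 /eqP.
  rewrite oppr_eq0 => /eqP u01; move/eqP: u0; apply.
  by apply: rV2P; rewrite mxE.
have /(congr1 (normalC (frame u y))) := frameE v.
rewrite normalCZ normalC_comb// => /eqP; rewrite scaler_eq0 (negbTE d0).
by move=> /eqP.
Qed.

Lemma normal_proj_translate u y z : W y -> u != 0 ->
  normal_proj phi y (translate (phi y) z) = translate (phi y) (normalC (frame u y) z).
Proof.
move=> Wy u0; have e0 := frame_neq0 Wy u0; have [w Jw] := J_frame u Wy.
apply: xget_unique.
  split=> [|_ [v _ <-]].
    exists ((dotC z (frame u y) / dotC (frame u y) (frame u y)) *: u +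
            (dotC z (mulI (frame u y)) / dotC (frame u y) (frame u y)) *: w) => //.
    rewrite -translateB (velocityE _ Wy); congr (translate _ _).
    rewrite (frameD _ _ Wy) !(frameZ _ _ Wy) Jw /normalC.
    by rewrite -[z - _ - _]addrA -opprD opprB [RHS]addrC subrK.
  rewrite (velocityE v Wy) metric_frame//.
  rewrite (normalC_eq0 (normalC_frame v Wy u0)) dotCDr !dotCZr.
  by rewrite normalC_orth// normalC_orthI// !mulr0 addr0 mulr0.
move=> w' [[v _ Ev] orth].
have w'E : w' = translate (phi y) (z - frame v y).
  by rewrite translateB -(velocityE v Wy) Ev opprB addrC subrK.
have orth' v' : dotC (z - frame v y) (frame v' y) = 0.
  have := orth _ (ex_intro2 _ _ v' I (erefl _)).
  rewrite w'E (velocityE v' Wy) metric_frame// => /eqP.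
  rewrite mulf_eq0 => /orP[|/eqP//].
  by rewrite mulf_eq0 invr_eq0 !pnatr_eq0.
rewrite w'E; congr (translate _ _).
have := normalC_id (orth' u); rewrite -Jw orth' => /(_ erefl) <-.
by rewrite normalCD -scaleN1r normalCZ (normalC_frame v Wy u0) scaler0 addr0.
Qed.

Lemma sff_translate u (X Y : E -> E) (a : E -> C3) y : W y -> u != 0 ->
  smooth_on W a -> (forall y, W y -> frame (Y y) y = a y) ->
  sff phi D X Y y = translate (phi y) (normalC (frame u y) (covariant (X y) a y)).
Proof.
move=> Wy u0 sa Ya; rewrite /sff -(normal_proj_translate _ Wy u0); congr normal_proj.
apply: cov_along_translate => // z Wz; rewrite /push (velocityE _ Wz).
by congr (translate _ _); exact: Ya.
Qed.

Lemma covariant_eq_on v (a b : E -> C3) y : W y -> (forall y, W y -> a y = b y) ->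
  covariant v a y = covariant v b y.
Proof. by move=> Wy ab; rewrite /covariant (derive_eq_on openW v ab Wy) (ab y Wy). Qed.

Lemma conj_cross_frame u v y : W y -> u != 0 ->
  conj_cross (frame v y) (frame u y) = 0.
Proof.
move=> Wy u0; rewrite (normalC_eq0 (normalC_frame v Wy u0)).
rewrite conj_crossDl !conj_crossZl conj_cross_mulIl conj_cross_self.
by rewrite mulI0 oppr0 !scaler0 addr0.
Qed.

(** Complex linearity of the second fundamental form in its second slot: the
    derivative of J, given by [conj_cross], vanishes on a complex line. *)
Lemma covariant_comb u v (s t : E -> R) (a : E -> C3) y : W y -> u != 0 ->
  smooth_on W s -> smooth_on W t ->
  (forall y, W y -> a y = s y *: frame u y + t y *: mulI (frame u y)) ->
  normalC (frame u y) (covariant v a y) =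
  s y *: normalC (frame u y) (covariant v (frame u) y) +
  t y *: mulI (normalC (frame u y) (covariant v (frame u) y)).
Proof.
move=> Wy u0 ss st aE; have e0 := frame_neq0 Wy u0.
rewrite (covariant_eq_on v Wy aE) /covariant.
rewrite (derive_comb openW v ss st (smooth_frame u) Wy).
rewrite conn_formDr !conn_formZr conn_form_mulI (conj_cross_frame v Wy u0).
rewrite mulI0 scaler0 subr0.
rewrite !normalCD !normalCZ !normalC_mulI (normalC_e e0) mulI0 !scaler0 !add0r.
by rewrite mulID !scalerDr addrACA.
Qed.

Lemma smooth_coef u (a : E -> C3) : u != 0 -> smooth_on W a ->
  smooth_on W (fun y => dotC (a y) (frame u y) / dotC (frame u y) (frame u y)) /\
  smooth_on W
    (fun y => dotC (a y) (mulI (frame u y)) / dotC (frame u y) (frame u y)).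
Proof.
move=> u0 sa; have se := smooth_frame u.
have sV : smooth_on W (fun y => (dotC (frame u y) (frame u y))^-1).
  apply: smoothV => // [y Wy|]; first by rewrite dotC_eq0 frame_neq0.
  exact: smooth_dotC.
by split; apply: smoothM => //; apply: smooth_dotC => //; exact: smooth_mulI.
Qed.

(** The vector h(e, e) for e = frame u. *)
Definition sff_diag u y := normalC (frame u y) (covariant u (frame u) y).

(** The symmetry of h carries the complex linearity in its second slot over to
    the first one, so that the one vector [sff_diag u y] generates all values. *)
Lemma second_form_complex_line u v (a : E -> C3) y : W y -> u != 0 -> smooth_on W a ->
  (forall y, W y -> normalC (frame u y) (a y) = 0) ->
  complex_line (sff_diag u y) (normalC (frame u y) (covariant v a y)).
Proof.
move=> Wy u0 sa a_tan.
have line b v' : smooth_on W b ->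
    (forall y, W y -> normalC (frame u y) (b y) = 0) ->
    complex_line (normalC (frame u y) (covariant v' (frame u) y))
      (normalC (frame u y) (covariant v' b y)).
  move=> sb b_tan; have [ss st] := smooth_coef u0 sb.
  rewrite (covariant_comb v' Wy u0 ss st (fun z Wz => normalC_eq0 (b_tan z Wz))).
  by eexists; eexists.
have [s [t ->]] := line a v sa a_tan.
have L : complex_line (sff_diag u y)
    (normalC (frame u y) (covariant v (frame u) y)).
  rewrite (covariant_sym v u Wy); apply: line; first exact: smooth_frame.
  by move=> z Wz; exact: normalC_frame.
apply: complex_lineD; first exact: complex_lineZ.
by apply: complex_lineZ; exact: complex_line_mulI.
Qed.

Variable G : E -> E -> E -> E.
Hypothesis HG : induced_levi_civita phi W G.

Lemma vector_field_cst v : vector_field W (fun=> setT) (fun=> v).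
Proof.
by split => //; exists W; split => //; exact: smooth_cst.
Qed.

Lemma cov_cst i j y : cov G (fun=> i) (fun=> j) y = G y i j.
Proof. by rewrite /cov derive_cst add0r. Qed.

Lemma induced_sym i j y : W y -> G y i j = G y j i.
Proof.
move=> Wy; have [_ tors _] := HG.
have := tors _ _ (vector_field_cst i) (vector_field_cst j) y Wy.
by rewrite !cov_cst !derive_cst subrr => /eqP; rewrite subr_eq0 => /eqP.
Qed.

Definition gram j k y : R := 4 / 3 * dotC (frame j y) (frame k y).

Lemma smooth_gram j k : smooth_on W (gram j k).
Proof.
apply: smoothM => //; first exact: smooth_cst.
by apply: smooth_dotC => //; exact: smooth_frame.
Qed.

Lemma derive_gram i j k y : W y -> 'D_i (gram j k) y =
  4 / 3 * (dotC (frame (G y i j) y) (frame k y) +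
           dotC (frame (G y i k) y) (frame j y)).
Proof.
move=> Wy; have [_ _ met] := HG.
have gE v w z : W z -> induced_metric phi z v w = gram v w z.
  by move=> Wz; rewrite /induced_metric (velocityE v Wz) (velocityE w Wz) metric_frame.
have dE : 'D_i (fun z => induced_metric phi z j k) y = 'D_i (gram j k) y.
  exact: (derive_eq_on openW i (gE j k) Wy).
have E1 := etrans (esym dE)
  (met _ _ _ (vector_field_cst i) (vector_field_cst j) (vector_field_cst k) y Wy).
rewrite E1 (cov_cst i j) (cov_cst i k) (gE _ _ _ Wy) (gE _ _ _ Wy).
by rewrite /gram -mulrDr (dotCC (frame j y)).
Qed.

(** Koszul's formula expresses the products of [G y i j] with all frame vectors
    by derivatives of the metric.  The condition on [w] says that frame u and
    frame w form a basis, so that these products determine [G y i j]; solving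
    for it in the orthogonal basis (e, i e), e = frame u, only divides by
    smooth functions without zeros. *)
Lemma connection_smooth u w i j : u != 0 ->
  (forall y, W y -> dotC (frame w y) (mulI (frame u y)) != 0) ->
  exists a : E -> C3, smooth_on W a /\ (forall y, W y -> frame (G y i j) y = a y).
Proof.
move=> u0 w0.
(* The factor 3/8 is 1/2 from Koszul's formula times 3/4 from the metric. *)
pose r k y := 3 / 8 * ('D_i (gram j k) y + 'D_j (gram i k) y - 'D_k (gram i j) y).
have sr k : smooth_on W (r k).
  apply: smoothM => //; first exact: smooth_cst.
  apply: smoothB => //; last exact: smooth_derive (smooth_gram i j).
  by apply: smoothD => //; exact: smooth_derive (smooth_gram _ _).
have rE k y : W y -> dotC (frame (G y i j) y) (frame k y) = r k y.
  move=> Wy; rewrite /r !derive_gram// (induced_sym j i Wy) (induced_sym k i Wy).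
  by rewrite (induced_sym k j Wy); field.
pose n y := dotC (frame u y) (frame u y).
pose a y := dotC (frame w y) (frame u y) / n y.
pose b y := dotC (frame w y) (mulI (frame u y)) / n y.
have n0 z : W z -> n z != 0 by move=> Wz; rewrite dotC_eq0 frame_neq0.
have se := smooth_frame u; have seI := smooth_mulI openW se.
have sn : smooth_on W n by exact: smooth_dotC.
have sV : smooth_on W (fun y => (n y)^-1) by exact: smoothV.
have [sa sb] : smooth_on W a /\ smooth_on W b.
  by apply: smooth_coef => //; exact: smooth_frame.
have b0 z : W z -> b z != 0 by move=> Wz; rewrite mulf_neq0 ?invr_eq0 ?w0 ?n0.
have sbV : smooth_on W (fun y => (b y)^-1) by exact: smoothV.
pose c y : C3 := (r u y / n y) *: frame u y +
  ((r w y - a y * r u y) / b y / n y) *: mulI (frame u y).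
exists c; rewrite /c; split.
  apply: smoothD => //; apply: smooth_scale => //; apply: smoothM => //.
  by apply: smoothM => //; apply: smoothB => //; exact: smoothM.
move=> y Wy; rewrite -(rE u y Wy).
have -> : (r w y - a y * dotC (frame (G y i j) y) (frame u y)) / b y =
    dotC (frame (G y i j) y) (mulI (frame u y)).
  rewrite -(rE w y Wy) {1}(normalC_eq0 (normalC_frame w Wy u0)) dotCDr !dotCZr.
  by rewrite -/(n y) -/(a y) -/(b y) addrC addKr mulrAC divff ?mul1r ?b0.
exact: (normalC_eq0 (normalC_frame _ Wy u0)).
Qed.

Hypothesis par : forall X Y Z : E -> E,
  vector_field W (fun=> setT) X -> vector_field W (fun=> setT) Y ->
  vector_field W (fun=> setT) Z ->
  forall x, W x -> cov_sff phi D G X Y Z x = 0.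

(** By parallelism, the normal derivative of h(X, Y) is the combination
    h(nabla_X X, Y) + h(X, nabla_X Y) of values of h; the second one is only
    available once nabla_X Y is known to be smooth. *)
Lemma parallel_complex_line u w v x : W x -> u != 0 ->
  (forall y, W y -> dotC (frame w y) (mulI (frame u y)) != 0) ->
  complex_line (sff_diag u x) (normalC (frame u x)
    (covariant u (fun y => normalC (frame u y) (covariant u (frame v) y)) x)).
Proof.
move=> Wx u0 w0.
have := par (vector_field_cst u) (vector_field_cst u) (vector_field_cst v) Wx.
have [a [sa aE]] := connection_smooth u v u0 w0.
have sv := smooth_frame v; have se := smooth_frame u.
have e0 y : W y -> frame u y != 0 by move=> Wy; exact: frame_neq0.
rewrite /cov_sff.
pose b y := normalC (frame u y) (covariant u (frame v) y).
have sb : smooth_on W b.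
  apply: smooth_normalC => //; apply: smoothD => //; first exact: smooth_derive.
  exact: smooth_conn_form.
have bE y : W y -> sff phi D (fun=> u) (fun=> v) y = translate (phi y) (b y).
  by move=> Wy; exact: (@sff_translate u _ _ (frame v)).
rewrite /normal_cov (cov_along_translate _ Wx sb bE) (normal_proj_translate _ Wx u0).
rewrite (@sff_translate u _ _ (frame v) x Wx u0 sv)//.
rewrite (@sff_translate u (fun=> u) _ a x Wx u0 sa); last first.
  by move=> y Wy; rewrite cov_cst; exact: aE.
rewrite -!translateB -[RHS](translate0 (phi x)) => /(translate_inj Wx)/eqP.
rewrite -addrA -opprD subr_eq0 => /eqP E1.
rewrite -/b [X in complex_line _ X]E1; apply: complex_lineD.
  by apply: second_form_complex_line => // y Wy; exact: normalC_frame.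
by apply: second_form_complex_line => // y Wy; rewrite -aE//; exact: normalC_frame.
Qed.

(** The derivatives of a = h(u, u) and of h(u, w) = s a + t i a both lie in the
    complex line of a.  Up to terms in this line, the second one is t times the
    derivative of J applied to a. *)
Lemma sff_diag_eq0 u w x : W x -> u != 0 ->
  (forall y, W y -> dotC (frame w y) (mulI (frame u y)) != 0) ->
  sff_diag u x = 0.
Proof.
move=> Wx u0 w0; have e0 := frame_neq0 Wx u0.
have se := smooth_frame u.
have [] := smooth_coef u0 (smooth_frame w).
set s := fun y => _ / _; set t := fun y => _ / _ => ss st.
have t0 : t x != 0 by rewrite mulf_neq0 ?invr_eq0 ?dotC_eq0 ?w0.
have sal : smooth_on W (sff_diag u).
  apply: smooth_normalC => // [y Wy|]; first exact: frame_neq0.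
  by apply: smoothD => //; [exact: smooth_derive|exact: smooth_conn_form].
have bE y : W y -> normalC (frame u y) (covariant u (frame w) y) =
    s y *: sff_diag u y + t y *: mulI (sff_diag u y).
  move=> Wy; apply: covariant_comb => // z Wz.
  exact: (normalC_eq0 (normalC_frame w Wz u0)).
have P1 := parallel_complex_line u Wx u0 w0.
have := parallel_complex_line w Wx u0 w0.
rewrite (covariant_eq_on u Wx bE) /covariant (derive_comb openW u ss st sal Wx).
rewrite -/(sff_diag u) in P1; rewrite conn_formDr !conn_formZr conn_form_mulI.
set A := 'D_u (sff_diag u) x; set g := conn_form (frame u x) (sff_diag u x).
set c := conj_cross (frame u x) (sff_diag u x).
have P1' : complex_line (sff_diag u x) (normalC (frame u x) A + normalC (frame u x) g).
  by rewrite -normalCD.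
have al_e : dotC (sff_diag u x) (frame u x) = 0 by exact: normalC_orth.
have al_Ie : dotC (sff_diag u x) (mulI (frame u x)) = 0 by exact: normalC_orthI.
have Nal : normalC (frame u x) (sff_diag u x) = sff_diag u x by exact: normalC_id.
have Nc : normalC (frame u x) c = c.
  by apply: normalC_id; [exact: dotC_conj_crossl|exact: dotC_conj_crossIl].
rewrite comb_rearrange.
rewrite !normalCD -scaleNr !normalCZ !normalC_mulI Nal Nc normalCD => P2.
apply: (conj_cross_complex_line al_e al_Ie _ e0).
have al := complex_line_self (sff_diag u x).
pose N := normalC (frame u x) A + normalC (frame u x) g.
have P3 : complex_line (sff_diag u x) ((t x * (2 / 3)) *: mulI c).
  have -> : (t x * (2 / 3)) *: mulI c = 'D_u s x *: sff_diag u x +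
      'D_u t x *: mulI (sff_diag u x) + s x *: N + t x *: mulI N -
      ('D_u s x *: sff_diag u x + 'D_u t x *: mulI (sff_diag u x) + s x *: N +
       t x *: mulI N + (- (t x * (2 / 3))) *: mulI c).
    by rewrite opprD addrA subrr sub0r scaleNr opprK.
  apply: complex_lineD; last exact: complex_lineN.
  by do ?apply: complex_lineD; apply: complex_lineZ => //; exact: complex_line_mulI.
rewrite -/c; have -> : c = - (t x * (2 / 3))^-1 *: mulI ((t x * (2 / 3)) *: mulI c).
  rewrite mulIZ mulIK !scalerN scaleNr opprK scalerA mulVf ?scale1r//.
  by rewrite mulf_neq0// mulf_neq0 ?invr_eq0 ?pnatr_eq0.
by apply: complex_lineZ; exact: complex_line_mulI.
Qed.

(** Otherwise frame w would be a real multiple of frame u. *)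
Lemma frame_det (u w : E) y : W y -> u != 0 -> (forall s, w != s *: u) ->
  dotC (frame w y) (mulI (frame u y)) != 0.
Proof.
move=> Wy u0 indep; apply/eqP => d0.
have := normalC_eq0 (normalC_frame w Wy u0); rewrite d0 mul0r scale0r addr0.
set s := _ / _ => Ew; have := indep s; rewrite -subr_eq0 => /eqP; apply.
apply: (frame_eq0 Wy).
by rewrite -scaleN1r (frameD _ _ Wy) !(frameZ _ _ Wy) scaleN1r Ew subrr.
Qed.

Lemma sff_eq0 (X Y : E -> E) x : vector_field W (fun=> setT) Y -> W x ->
  sff phi D X Y x = 0.
Proof.
move=> [[U [_ WU sY]] _] Wx.
have u0 : 'e_0 != 0 :> E by apply/eqP => /rowP/(_ 0)/eqP; rewrite !mxE/= oner_eq0.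
have indep s : 'e_1 != s *: 'e_0 :> E.
  by apply/eqP => /rowP/(_ 1)/eqP; rewrite !mxE/= mulr0 oner_eq0.
have al := sff_diag_eq0 Wx u0 (fun y Wy => frame_det Wy u0 indep).
have {}sY : smooth_on W Y by apply: smooth_onS WU sY.
pose a y := Y y 0 0 *: frame 'e_0 y + Y y 0 1 *: frame 'e_1 y.
have sa : smooth_on W a.
  apply: smoothD => //; apply: smooth_scale => //; try exact: smooth_coord.
    exact: smooth_frame.
  exact: smooth_frame.
have aE y : W y -> frame (Y y) y = a y.
  move=> Wy; rewrite /a -!(frameZ _ _ Wy) -(frameD _ _ Wy); congr frame.
  by apply: rV2P; rewrite !mxE/= !mulr1 !mulr0 ?addr0 ?add0r.
rewrite (sff_translate X Wx u0 sa aE).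
rewrite (_ : normalC _ _ = 0) ?translate0//; apply: complex_line0; rewrite -al.
by apply: second_form_complex_line => // y Wy; rewrite -aE//; exact: normalC_frame.
Qed.

End ImmersedChart.

(** * Parallel almost complex surfaces *)

Theorem theorem3p12 (R : realType)
    (D : quat R * quat R -> quat R * quat R -> quat R * quat R ->
         quat R * quat R)
    (HD : nk_levi_civita D)
    (M : smooth_surface R) (f : M -> quat R * quat R)
    (Hf : almost_complex_surface f)
    (nabla : chart R M -> 'rV[R]_2 -> 'rV[R]_2 -> 'rV[R]_2 -> 'rV[R]_2)
    (Hnabla : surface_levi_civita f nabla)
    (Hpar : parallel_sff f D nabla) :
  totally_geodesic f D.
Proof.
move: Hf => [[f_S3S3 f_imm] f_J] c atlas_c X Y _ fieldY x img_x.
have [[_ open_img] _ _ _ _] := atlas_chart atlas_c.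
have [smooth_rep imm_rep] := f_imm c atlas_c.
apply: (sff_eq0 open_img _ smooth_rep imm_rep (f_J c atlas_c) HD
  (Hnabla c atlas_c) (Hpar c atlas_c) X fieldY img_x).
by move=> y _; exact: f_S3S3.
Qed.
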